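(* Let $n\geq 3$. Then $$\kappa^s(Q_n;C_k)=\begin{cases}\lceil\frac{2n}{k+1}\rceil & k \text{ odd},\ 3\leq k\leq 2^{n-1},\\ \lceil\frac{2n}{k}\rceil & k\text{ even},\ 4\leq k\leq 2^{n-1},\end{cases}$$ and $$\kappa(Q_n;C_k)\ \begin{cases} =2 & n=3,\ k=4,\\ =n-2 & n\geq 4,\ k=4,\\ =\lceil\frac{2n}{k}\rceil & n\geq 5,\ k \text{ even},\ 6\leq k\leq 2^{n-2},\\ \geq \lceil\frac{2n}{k}\rceil & n\geq 4,\ k\text{ even},\ 2^{n-2}+2\leq k\leq 2^{n-1}.\end{cases}$$
   Context: $Q_n$ is the $n$-dimensional hypercube: its vertices are the binary strings of length $n$, two vertices being adjacent iff they differ in exactly one position. $C_k$ denotes the cycle of length $k$. For connected graphs $G,H$: an $H$-structure cut of $G$ is a set $F$ of subgraphs of $G$, each isomorphic to $H$, such that $G-V(F)$ is disconnected or trivial (a single vertex); an $H$-substructure cut is defined the same way except that each member of $F$ is isomorphic to a connected subgraph of $H$. $\kappa(G;H)$ (resp. $\kappa^s(G;H)$) is the minimum cardinality of an $H$-structure cut (resp. $H$-substructure cut) of $G$. *)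

(* Defs.v *)
From HB Require Import structures.
From mathcomp Require Import all_boot.
Set Implicit Arguments.
Unset Strict Implicit.
Unset Printing Implicit Defensive.

Record sgraph := SGraph {
  vertex :> finType;
  adj : rel vertex;
  adj_sym : symmetric adj;
  adj_irrefl : irreflexive adj }.

(* The graph without vertices is not connected: a family covering all the
   vertices of a graph disconnects it. *)
Definition connected (G : sgraph) : Prop :=
  0 < #|G| /\ forall x y : G, connect (@adj G) x y.

Definition trivial_graph (G : sgraph) : Prop := #|G| = 1.

Definition isomorphic (G H : sgraph) : Prop :=
  exists f : G -> H, bijective f /\ forall x y : G, adj (f x) (f y) = adj x y.

(* An undirected edge {x, y} is encoded by both ordered pairs (x, y) and
   (y, x), so that two subgraphs are equal iff they have the same vertices
   and the same edges. *)
Record subgraph (G : sgraph) := Subgraph {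
  sub_data : {set G} * {set G * G};
  sub_wf : [forall x, forall y, ((x, y) \in sub_data.2) ==>
     [&& adj x y, x \in sub_data.1, y \in sub_data.1
       & (y, x) \in sub_data.2]] }.

HB.instance Definition _ (G : sgraph) := [isSub for @sub_data G].
HB.instance Definition _ (G : sgraph) := [Finite of subgraph G by <:].

Definition sub_vertices (G : sgraph) (S : subgraph G) : {set G} :=
  (sub_data S).1.
Definition sub_edges (G : sgraph) (S : subgraph G) : {set G * G} :=
  (sub_data S).2.

Section SubgraphAsGraph.
Variables (G : sgraph) (S : subgraph G).

Definition sub_adj : rel {x : G | x \in sub_vertices S} :=
  fun x y => (val x, val y) \in sub_edges S.

Lemma sub_adj_sym : symmetric sub_adj.
Proof.
have symS x y : (x, y) \in sub_edges S -> (y, x) \in sub_edges S.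
  by move=> xy; have /forallP/(_ x)/forallP/(_ y) := sub_wf S;
     move/implyP/(_ xy)/and4P => [].
by move=> x y; apply/idP/idP; apply: symS.
Qed.

Lemma sub_adj_irrefl : irreflexive sub_adj.
Proof.
move=> x; apply/negP => xx.
have /forallP/(_ (val x))/forallP/(_ (val x)) := sub_wf S.
by move/implyP/(_ xx)/and4P => [+ _ _ _]; rewrite adj_irrefl.
Qed.

Definition graph_of_sub : sgraph := SGraph sub_adj_sym sub_adj_irrefl.
End SubgraphAsGraph.

Section Delete.
Variables (G : sgraph) (X : {set G}).

Definition delete_adj : rel {x : G | x \notin X} :=
  fun x y => adj (val x) (val y).

Lemma delete_adj_sym : symmetric delete_adj.
Proof. by move=> x y; apply: adj_sym. Qed.

Lemma delete_adj_irrefl : irreflexive delete_adj.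
Proof. by move=> x; apply: adj_irrefl. Qed.

Definition delete : sgraph := SGraph delete_adj_sym delete_adj_irrefl.
End Delete.

Definition family_vertices (G : sgraph) (F : {set subgraph G}) : {set G} :=
  \bigcup_(S in F) sub_vertices S.

Definition separating (G : sgraph) (F : {set subgraph G}) : Prop :=
  ~ connected (delete (family_vertices F)) \/
  trivial_graph (delete (family_vertices F)).

Definition structure_cut (G H : sgraph) (F : {set subgraph G}) : Prop :=
  (forall S, S \in F -> isomorphic (graph_of_sub S) H) /\ separating F.

Definition substructure_cut (G H : sgraph) (F : {set subgraph G}) : Prop :=
  (forall S, S \in F -> exists K : subgraph H,
     connected (graph_of_sub K) /\
     isomorphic (graph_of_sub S) (graph_of_sub K)) /\ separating F.

Definition is_min_card (T : finType) (P : {set T} -> Prop) (m : nat) : Prop :=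
  (exists F, P F /\ #|F| = m) /\ forall F, P F -> m <= #|F|.

Lemma is_min_card_inj (T : finType) (P : {set T} -> Prop) m1 m2 :
  is_min_card P m1 -> is_min_card P m2 -> m1 = m2.
Proof.
move=> [[F1 [P1 <-]] min1] [[F2 [P2 <-]] min2].
by apply/eqP; rewrite eqn_leq min1 ?min2.
Qed.

(* is_kappa G H m reads "kappa(G;H) = m": a minimum cut exists and has
   cardinality m, which is unique by is_min_card_inj. *)
Definition is_kappa (G H : sgraph) (m : nat) : Prop :=
  is_min_card (@structure_cut G H) m.

Definition is_kappa_s (G H : sgraph) (m : nat) : Prop :=
  is_min_card (@substructure_cut G H) m.

Section Hypercube.
Variable n : nat.

Definition cube_adj : rel (n.-tuple bool) :=
  fun x y => #|[set i | tnth x i != tnth y i]| == 1.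

Lemma cube_adj_sym : symmetric cube_adj.
Proof.
by move=> x y; congr (_ == _); apply: eq_card => i; rewrite !inE eq_sym.
Qed.

Lemma cube_adj_irrefl : irreflexive cube_adj.
Proof.
move=> x; rewrite /cube_adj (_ : [set i | _] = set0) ?cards0 //.
by apply/setP => i; rewrite !inE eqxx.
Qed.

Definition hypercube : sgraph := SGraph cube_adj_sym cube_adj_irrefl.
End Hypercube.

Section Cycle.
Variable k : nat.

(* ordS is the successor modulo k; the condition i != j only matters for
   k = 1. This is the cycle of length k when 3 <= k. *)
Definition cycle_adj : rel 'I_k :=
  fun i j => (i != j) && ((j == ordS i) || (i == ordS j)).

Lemma cycle_adj_sym : symmetric cycle_adj.
Proof. by move=> i j; rewrite /cycle_adj eq_sym orbC. Qed.

Lemma cycle_adj_irrefl : irreflexive cycle_adj.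
Proof. by move=> i; rewrite /cycle_adj eqxx. Qed.

Definition cycle_graph : sgraph := SGraph cycle_adj_sym cycle_adj_irrefl.
End Cycle.

(* The ceiling of a / b, for 0 < b; see ceil_div_leq. *)
Definition ceil_div (a b : nat) : nat := (a + b.-1) %/ b.

Lemma ceil_div_leq a b m : 0 < b -> (ceil_div a b <= m) = (a <= m * b).
Proof.
case: b => // b _.
by rewrite /ceil_div -ltnS ltn_divLR //= mulSn addSn ltnS addnC leq_add2l.
Qed.

(* Main.v *)
Require Import Defs.
From mathcomp Require Import all_boot.
From mathcomp Require Import zify.
From Stdlib Require Import Classical.
Set Implicit Arguments.
Unset Strict Implicit.
Unset Printing Implicit Defensive.

(** Lower bounds. A connected subgraph of [C_k] misses at most one successor edge
    [(i, i + 1)] at its own vertices, so its two colour classes differ by at most one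
    and each of them has at most [uphalf k] vertices. If fewer than [n / uphalf k]
    pieces are deleted, then fewer than [n] vertices of each parity are deleted. By
    induction on subcubes such a deletion of at most [2n - 3] vertices leaves [Q_n]
    connected: cut along a direction for which one half [H] is connected by induction;
    if an edge [xy] of the other half cannot reach [H], then for each of the
    [2(n - 1)] neighbours [z] of [x] or [y] in their half, [z] or its mirror image in
    [H] is deleted. The only disconnecting deletion of [2n - 2] vertices is the
    neighbourhood of an edge, which induces a perfect matching and so contains no
    piece with three vertices. For [C_4], a union of at most [n - 3] faces is treated
    by a similar induction: a deleted face of [Q_n] crossing a cut is symmetric
    under it.

    Upper bounds. Isolate the vertex [0] with zigzags
    [{s}, {s, s+1}, {s+1}, {s+1, s+2}, ...] through its neighbours, closed up into
    cycles or, when [k > 2n], prolonged by a detour; for [C_4], isolate a face by the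
    [n - 2] parallel adjacent faces. *)

(** * Flips, parity and subcubes *)

Arguments cube_adj : simpl never.

Section Cube.
Variable n : nat.
Implicit Types (x y z v b : n.-tuple bool) (l i j : 'I_n).
Implicit Types (I : {set 'I_n}) (A D : {set n.-tuple bool}).

Definition flip l x : n.-tuple bool := [tuple tnth x j (+) (j == l) | j < n].

Lemma tnth_flip l x j : tnth (flip l x) j = tnth x j (+) (j == l).
Proof. by rewrite tnth_mktuple. Qed.

Lemma flipK l : involutive (flip l).
Proof. by move=> x; apply: eq_from_tnth => j; rewrite !tnth_flip addbK. Qed.

Lemma flipC i j x : flip i (flip j x) = flip j (flip i x).
Proof. by apply: eq_from_tnth => l; rewrite !tnth_flip addbAC. Qed.

Lemma flip_eq i j x : (flip i x == flip j x) = (i == j).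
Proof.
apply/idP/idP => [/eqP E | /eqP -> //].
have := congr1 (fun y : n.-tuple bool => tnth y i) E.
by rewrite !tnth_flip eqxx; case: (tnth _ _); case: eqP.
Qed.

Lemma flip_neq i x : flip i x != x.
Proof.
apply/eqP => E; have := congr1 (fun y : n.-tuple bool => tnth y i) E.
by rewrite tnth_flip eqxx; case: (tnth _ _).
Qed.

Lemma cube_adjP x y : reflect (exists l, y = flip l x) (cube_adj x y).
Proof.
apply: (iffP cards1P) => [[l E] | [l ->]]; exists l.
  apply: eq_from_tnth => j; rewrite tnth_flip.
  have := in_set1 j l; rewrite -E inE => <-.
  by case: (tnth _ _); case: (tnth _ _).
apply/setP => j; rewrite !inE tnth_flip.
by case: (tnth x j); case: (j == l).
Qed.

Lemma cube_adj_flip l x : cube_adj x (flip l x).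
Proof. by apply/cube_adjP; exists l. Qed.

Definition parity x := \big[addb/false]_j tnth x j.

Lemma parity_flip l x : parity (flip l x) = ~~ parity x.
Proof.
rewrite /parity (eq_bigr _ (fun j _ => tnth_flip l x j)) big_split /=.
rewrite [X in _ (+) X](bigD1 l) //= eqxx [X in true (+) X]big1 ?addbF ?addbT //.
by move=> j /negPf ->.
Qed.

(** The lock keeps [inE] from unfolding membership; [cubeP] opens it. A half of [cube I b] is
    written [cube (I :\ i) v], where the base point [v] selects the half. *)
Definition cube I b :=
  locked [set x | [forall j, (j \notin I) ==> (tnth x j == tnth b j)]].

Lemma cubeP I b x :
  reflect (forall j, j \notin I -> tnth x j = tnth b j) (x \in cube I b).
Proof.
rewrite /cube -lock inE; apply: (iffP forallP) => H j; first by move/(implyP (H j))/eqP.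
by apply/implyP => /H ->.
Qed.

Lemma cube_refl I b : b \in cube I b.
Proof. by apply/cubeP. Qed.

Lemma cubeT b : cube setT b = setT.
Proof. by apply/setP => x; rewrite inE; apply/cubeP => j; rewrite inE. Qed.

Lemma cube_flip I b l x : l \in I -> (flip l x \in cube I b) = (x \in cube I b).
Proof.
move=> lI; suff H y : y \in cube I b -> flip l y \in cube I b.
  by apply/idP/idP => /H //; rewrite flipK.
move=> /cubeP yb; apply/cubeP => j jI; rewrite tnth_flip yb //.
by rewrite (negPf (memPnC jI _ lI)) addbF.
Qed.

Lemma half_tnth I i v x : x \in cube (I :\ i) v -> tnth x i = tnth v i.
Proof. by move/cubeP; apply; rewrite !inE eqxx. Qed.

Lemma in_half I b i v x : v \in cube I b -> i \in I ->
  (x \in cube (I :\ i) v) = (x \in cube I b) && (tnth x i == tnth v i).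
Proof.
move=> /cubeP vb iI; apply/idP/andP => [xv | [/cubeP xb /eqP xi]].
  rewrite (half_tnth xv) eqxx; split=> //; apply/cubeP => j jI.
  by rewrite -vb //; move/cubeP: xv; apply; rewrite !inE negb_and jI orbT.
apply/cubeP => j; rewrite !inE negb_and negbK => /orP[/eqP -> // | jI].
by rewrite xb // vb.
Qed.

(** A relation on all vertices, so that [A] can vary without a change of type; a vertex outside [A]
    is connected only to itself. *)
Definition induced A x y := [&& x \in A, y \in A & cube_adj x y].

Lemma induced_sym A : connect_sym (induced A).
Proof.
by apply: sym_connect_sym => x y; rewrite /induced cube_adj_sym andbCA.
Qed.

Lemma induced_sub A A' x y : A \subset A' ->
  connect (induced A) x y -> connect (induced A') x y.
Proof.
move/subsetP => sAA'; apply: connect_sub => u w /and3P[uA wA uw].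
by apply: connect1; rewrite /induced !sAA'.
Qed.

Lemma connect_flip A l x : x \in A -> flip l x \in A ->
  connect (induced A) x (flip l x).
Proof. by move=> xA lA; apply: connect1; rewrite /induced xA lA cube_adj_flip. Qed.

Lemma connect_in A x y : x \in A -> connect (induced A) x y -> y \in A.
Proof.
move=> xA /connectP[p]; elim: p x xA => [|z p IH] x xA /=; first by move=> _ ->.
by case/andP => /and3P[_ zA _]; apply: IH.
Qed.

Definition conn A := forall x y, x \in A -> y \in A -> connect (induced A) x y.

(** If every survivor reached the connected half, all would be joined through it. So the component
    of some [x0] avoids that half, and a surviving mirror image of one of its vertices would lead
    into it. The [#|I|] neighbours of [x0] share one parity, so one of them survives; its direction
    is not [i], as the mirror image of [x0] is deleted. *)
Lemma half_obstruction I b i D v x y :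
    i \in I -> v \in cube I b -> conn (cube (I :\ i) v :\: D) ->
    (forall c, #|[set z in D :&: cube I b | parity z == c]| < #|I|) ->
    x \in cube I b :\: D -> y \in cube I b :\: D ->
    ~~ connect (induced (cube I b :\: D)) x y ->
  exists x0 j, [/\ x0 \in cube I b :\: D, j \in I :\ i, flip j x0 \notin D &
    forall z, connect (induced (cube I b :\: D)) x0 z ->
      flip i z \in D /\ tnth z i != tnth v i].
Proof.
move=> iI vC cH few xA yA; set A := cube I b :\: D => nxy.
have halfE z := in_half z vC iI.
have HA : cube (I :\ i) v :\: D \subset A.
  by apply/subsetP => z; rewrite !inE halfE => /and3P[-> ->].
pose reach x := [exists z, connect (induced A) x z && (z \in cube (I :\ i) v :\: D)].
have [x0 x0A nreach] : exists2 x0, x0 \in A & ~~ reach x0.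
  case rx : (reach x); last by exists x; rewrite ?rx.
  exists y => //; apply: contra nxy => /existsP[w /andP[yw wH]].
  have /existsP[z /andP[xz zH]] := rx.
  apply: connect_trans xz _; rewrite induced_sym; apply: connect_trans yw _.
  by apply: induced_sub HA _; apply: cH.
have far z : connect (induced A) x0 z -> flip i z \in D /\ tnth z i != tnth v i.
  move=> xz; have zA := connect_in x0A xz.
  have zi : tnth z i != tnth v i.
    apply: contra nreach => zi; apply/existsP; exists z.
    by move: zA; rewrite xz /= !inE !halfE => /andP[-> ->].
  split=> //; apply: contraR nreach => zD; apply/existsP; exists (flip i z).
  have fH : flip i z \in cube (I :\ i) v :\: D.
    rewrite inE zD halfE cube_flip //; move: zA; rewrite inE => /andP[_ ->].
    by rewrite tnth_flip eqxx addbT; move: zi; case: (tnth _ _); case: (tnth _ _).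
  rewrite fH andbT; apply: connect_trans xz _; apply: connect_flip => //.
  exact: (subsetP HA).
have [l lI lD] : exists2 l, l \in I & flip l x0 \notin D.
  apply/exists_inP; apply: contraTT (few (~~ parity x0)) => /exists_inPn H.
  rewrite -leqNgt -(card_in_imset (f := flip^~ x0)); last first.
    by move=> p q _ _ /eqP; rewrite flip_eq => /eqP.
  apply: subset_leq_card; apply/subsetP => _ /imsetP[l lI ->].
  move: x0A; rewrite !inE => /andP[_]; rewrite parity_flip eqxx andbT.
  by rewrite cube_flip // => ->; rewrite andbT; move: (H l lI); rewrite negbK.
exists x0, l; split=> //; rewrite !inE lI andbT; apply: contraNneq lD => ->.
by have [] := far x0 (connect0 _ _).
Qed.

End Cube.

(** * Connectivity after deleting few vertices of each parity *)

Section BalancedDeletion.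
Variable n : nat.
Implicit Types (x y z v b : n.-tuple bool) (l i j : 'I_n).
Implicit Types (I : {set 'I_n}) (A B D : {set n.-tuple bool}).

Definition side A c := [set z in A | parity z == c].

Lemma card_side A c : #|side A c| + #|side A (~~ c)| = #|A|.
Proof.
rewrite -(cardsID [set z | parity z == c] A); congr (_ + _); apply: eq_card => z.
  by rewrite !inE.
by rewrite !inE andbC; case: (parity z); case: c.
Qed.

Lemma side_sub A B c : A \subset B -> #|side A c| <= #|side B c|.
Proof.
move=> /subsetP sAB; apply/subset_leq_card/subsetP => z.
by rewrite !inE => /andP[/sAB -> ->].
Qed.

Lemma half_sub I b i v : v \in cube I b -> cube (I :\ i) v \subset cube I b.
Proof.
move=> /cubeP vb; apply/subsetP => z /cubeP zv; apply/cubeP => j jI.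
by rewrite zv ?vb // !inE negb_and jI orbT.
Qed.

Lemma card_halves I b i p q D c : p \in cube I b -> q \in cube I b ->
  tnth p i != tnth q i ->
  #|side (D :&: cube (I :\ i) p) c| + #|side (D :&: cube (I :\ i) q) c|
    <= #|side (D :&: cube I b) c|.
Proof.
move=> pC qC pq.
rewrite -cardsUI (_ : side _ _ :&: side _ _ = set0) ?cards0 ?addn0.
  apply/subset_leq_card/subsetP => z; rewrite !in_set.
  by case/orP=> /andP[/andP[-> H] ->]; rewrite !andbT /=;
     apply: (subsetP (half_sub i _)) H.
apply/setP => z; rewrite !in_set; apply: contraNF pq.
by case/andP => /andP[/andP[_ /half_tnth <-] _] /andP[/andP[_ /half_tnth <-] _].
Qed.

(** [T] picks, for each end [z] of the edge and each direction [l], the vertex [flip l z] if it is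
    deleted and its mirror image otherwise. The case [l = j] is included, so the two ends count as
    neighbours of each other. *)
Lemma obstruction_set I i D x j : j \in I :\ i -> i \in I ->
    (forall l z, l \in I :\ i -> z = x \/ z = flip j x ->
       flip l z \in D \/ flip i (flip l z) \in D) ->
  exists T : {set n.-tuple bool}, [/\ T \subset D, T \subset cube I x,
    #|T| = 2 * #|I :\ i| &
    forall t, t \in T -> exists l z, [/\ l \in I :\ i, z = x \/ z = flip j x &
      t = flip l z \/ flip l z \notin D /\ t = flip i (flip l z)]].
Proof.
move=> jI iI H.
pose base c := if c then flip j x else x.
pose f (p : 'I_n * bool) :=
  let z := flip p.1 (base p.2) in if z \in D then z else flip i z.
have baseP c : base c = x \/ base c = flip j x by case: c; [right | left].
have iIi l : l \in I :\ i -> (i == l) = false.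
  by rewrite !inE eq_sym => /andP[/negPf].
have tb c : tnth (base c) i = tnth x i.
  by rewrite /base; case: c; rewrite ?tnth_flip // iIi // addbF.
(* Reflecting everything into the half of [x] undoes the choice made by [f]; parity then tells the
   two ends of the edge apart. *)
pose g z := if tnth z i == tnth x i then z else flip i z.
have gf p : p.1 \in I :\ i -> g (f p) = flip p.1 (base p.2).
  move=> pI; rewrite /f /=; set z := flip _ _.
  have zi : tnth z i = tnth x i by rewrite tnth_flip iIi // addbF tb.
  rewrite /g; case: (z \in D); rewrite ?zi ?eqxx // tnth_flip eqxx zi flipK.
  by case: (tnth x i).
have fi : {in setX (I :\ i) setT &, injective f}.
  move=> [l c] [l' c']; rewrite !in_setX !in_setT !andbT /= => lI lI' E.
  have := congr1 g E; rewrite !gf //= => E1.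
  have cc : c = c'.
    have := congr1 (@parity n) E1; rewrite !parity_flip /base.
    by case: c {E E1}; case: c'; rewrite ?parity_flip //; case: parity.
  by move: E1; rewrite cc => /eqP; rewrite flip_eq => /eqP ->.
exists (f @: setX (I :\ i) setT); split.
- apply/subsetP => t /imsetP[[l c]]; rewrite in_setX in_setT andbT /= => lI ->.
  rewrite /f /=; case: ifP => // /negbT lD.
  by case: (H l _ lI (baseP c)) => //; rewrite (negPf lD).
- apply/subsetP => t /imsetP[[l c]]; rewrite in_setX in_setT andbT /= => lI ->.
  have lI' : l \in I by move: lI; rewrite !inE => /andP[].
  have jI' : j \in I by move: jI; rewrite !inE => /andP[].
  by rewrite /f /base /=; case: ifP => _; case: c; rewrite !cube_flip ?cube_refl.
- by rewrite card_in_imset // cardsX cardsT card_bool mulnC.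
- move=> t /imsetP[[l c]]; rewrite in_setX in_setT andbT /= => lI ->.
  exists l, (base c); split=> //; rewrite /f /=.
  by case: ifP => lD; [left | right].
Qed.

(** Here [d] is the dimension of a half, [a] and [b] count its deleted vertices of the two parities,
    and [a'] and [b'] those of the opposite half. The total is at most [(d - 1) + d./2], which is at
    most [2 * d - 3] once [3 <= d]. *)
Lemma good_half_arith (a b a' b' e o d P : nat) : 0 < a' -> a + a' <= e -> b + b' <= o ->
  e < d.+1 -> o < d.+1 -> 2 < d.+1 -> a + b = P -> b <= b' ->
  [/\ a < d, b < d & 2 < d -> P <= 2 * d - 3].
Proof. by split; lia. Qed.

(** Finds a half to which the induction applies. A direction that separates two deleted vertices of
    the same parity leaves one of them in each half; the half with at most as many deleted vertices
    of the other parity is taken. If no parity has two deleted vertices, any half works. *)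
Lemma good_half I b D : 2 < #|I| ->
    (forall c, #|side (D :&: cube I b) c| < #|I|) ->
  exists i v, [/\ i \in I, v \in cube I b,
    forall c, #|side (D :&: cube (I :\ i) v) c| < #|I :\ i| &
    2 < #|I :\ i| -> #|D :&: cube (I :\ i) v| <= 2 * #|I :\ i| - 3].
Proof.
move=> I2 few.
have cI i : i \in I -> #|I| = #|I :\ i|.+1 by move=> iI; rewrite (cardsD1 i) iI.
case: (boolP [exists c, 1 < #|side (D :&: cube I b) c|]) => [/existsP[c] | /existsPn le1].
  case/card_gt1P => p [q [pD qD pq]].
  have [[pD' pC] pc] : (p \in D /\ p \in cube I b) /\ parity p == c.
    by move: pD; rewrite !in_set => /andP[/andP[-> ->] ->].
  have [[qD' qC] qc] : (q \in D /\ q \in cube I b) /\ parity q == c.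
    by move: qD; rewrite !in_set => /andP[/andP[-> ->] ->].
  have [i pqi] : exists i, tnth p i != tnth q i.
    apply/existsP; apply: contraNT pq => /existsPn H.
    by apply/eqP/eq_from_tnth => i; apply/eqP; move: (H i); rewrite negbK.
  have iI : i \in I.
    apply: contraNT pqi => iI.
    by move/cubeP: pC => ->//; move/cubeP: qC => ->.
  have Dp : 0 < #|side (D :&: cube (I :\ i) p) c|.
    by apply/card_gt0P; exists p; rewrite !in_set pD' cube_refl.
  have Dq : 0 < #|side (D :&: cube (I :\ i) q) c|.
    by apply/card_gt0P; exists q; rewrite !in_set qD' cube_refl.
  have s1 := card_halves D c pC qC pqi; have s2 := card_halves D (~~ c) pC qC pqi.
  have f1 := few c; have f2 := few (~~ c); have cIi := cI i iI.
  have cc c' : c' = c \/ c' = ~~ c by case: (c); case: c'; auto.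
  have tp := card_side (D :&: cube (I :\ i) p) c.
  have tq := card_side (D :&: cube (I :\ i) q) c.
  have [le|le] := leqP #|side (D :&: cube (I :\ i) p) (~~ c)|
                       #|side (D :&: cube (I :\ i) q) (~~ c)|.
    rewrite cIi in f1 f2 I2.
    have [u1 u2 u3] := good_half_arith Dq s1 s2 f1 f2 I2 tp le.
    by exists i, p; split=> // c'; case: (cc c') => ->.
  rewrite cIi in f1 f2 I2; rewrite addnC in s1; rewrite addnC in s2.
  have [u1 u2 u3] := good_half_arith Dp s1 s2 f1 f2 I2 tq (ltnW le).
  by exists i, q; split=> // c'; case: (cc c') => ->.
have [i iI] : exists i, i \in I by apply/card_gt0P; apply: leq_trans I2.
have small c : #|side (D :&: cube (I :\ i) b) c| <= 1.
  apply: leq_trans (side_sub _ _) _; last by rewrite leqNgt; exact: le1.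
  exact/setIS/half_sub/cube_refl.
exists i, b; rewrite cube_refl; have cIi := cI i iI; split=> //.
  by move=> c; have := small c; lia.
have := card_side (D :&: cube (I :\ i) b) true.
by have /= := small true; have /= := small false; lia.
Qed.

(** A surviving neighbour of the edge from [x0] to [flip j x0] belongs to the component of [x0], so
    its mirror image is deleted; this is the hypothesis of [obstruction_set]. *)
Lemma obstruction I b i D v x y :
    i \in I -> v \in cube I b -> conn (cube (I :\ i) v :\: D) ->
    (forall c, #|side (D :&: cube I b) c| < #|I|) ->
    x \in cube I b :\: D -> y \in cube I b :\: D ->
    ~~ connect (induced (cube I b :\: D)) x y ->
  exists x0 j (T : {set n.-tuple bool}), [/\ x0 \in cube I b :\: D, j \in I :\ i, flip j x0 \notin D,
    forall z, connect (induced (cube I b :\: D)) x0 z ->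
      flip i z \in D /\ tnth z i != tnth v i &
  [/\ T \subset D :&: cube I b, #|T| = 2 * #|I :\ i| &
    forall t, t \in T -> exists l z, [/\ l \in I :\ i, z = x0 \/ z = flip j x0 &
      t = flip l z \/ flip l z \notin D /\ t = flip i (flip l z)]]].
Proof.
move=> iI vC cH few xA yA nxy.
have [x0 [j [x0A jI jD far]]] := half_obstruction iI vC cH few xA yA nxy.
have jI' : j \in I by move: jI; rewrite !inE => /andP[].
have [x0D x0C] : x0 \notin D /\ x0 \in cube I b.
  by move: x0A; rewrite in_setD => /andP[].
have jA : flip j x0 \in cube I b :\: D by rewrite in_setD jD cube_flip.
have [l z lI zx | T [TD TC cT HT]] := obstruction_set (D := D) (x := x0) jI iI.
  case: (boolP (flip l z \in D)) => lD; [by left | right].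
  have lI' : l \in I by move: lI; rewrite !inE => /andP[].
  have zA : z \in cube I b :\: D by case: zx => ->.
  apply: (proj1 (far _ _)); apply: (@connect_trans _ _ z).
    by case: zx zA => -> zA; [exact: connect0 | exact: connect_flip].
  apply: connect_flip => //; rewrite in_setD lD cube_flip //.
  by move: zA; rewrite in_setD => /andP[].
exists x0, j, T; split=> //; split=> //; rewrite subsetI TD.
apply: subset_trans TC _; apply/subsetP => z /cubeP zx.
by apply/cubeP => l lI; rewrite zx //; move/cubeP: x0C; apply.
Qed.

Lemma cube_eq I b x y : x \in cube I b -> y \in cube I b ->
  {in I, forall l, tnth x l = tnth y l} -> x = y.
Proof.
move=> /cubeP xb /cubeP yb xy; apply: eq_from_tnth => l.
by case: (boolP (l \in I)) => lI; [exact: xy | rewrite xb ?yb].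
Qed.

(** Above dimension 2, a disconnection would yield [2 * #|I| - 2] deleted vertices by [obstruction],
    one more than the total allows. The total is bounded only there because a square that loses one
    vertex of each parity stays connected, although [2 > 2 * 2 - 3]. *)
Lemma conn_balanced I b D : 0 < #|I| ->
    (forall c, #|side (D :&: cube I b) c| < #|I|) ->
    (2 < #|I| -> #|D :&: cube I b| <= 2 * #|I| - 3) ->
  conn (cube I b :\: D).
Proof.
move: {2}#|I| (leqnn #|I|) => d; elim: d I b => [|d IH] I b dI I0 few tot; first by lia.
have [I2|I2] := leqP #|I| 2; last first.
  move=> x y xA yA; apply/idPn => nxy.
  have [i [v [iI vC few' tot']]] := good_half I2 few.
  have cI : #|I| = #|I :\ i|.+1 by rewrite (cardsD1 i) iI.
  have cH : conn (cube (I :\ i) v :\: D) by apply: IH => //; lia.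
  have [x0 [j [T [_ _ _ _ [TD cT _]]]]] := obstruction iI vC cH few xA yA nxy.
  by have := subset_leq_card TD; have := tot I2; lia.
move=> x y xA yA.
have [xD xC] : x \notin D /\ x \in cube I b by move: xA; rewrite in_setD => /andP[].
have [yD yC] : y \notin D /\ y \in cube I b by move: yA; rewrite in_setD => /andP[].
have two c p q : p \in D -> q \in D -> p \in cube I b -> q \in cube I b ->
    parity p = c -> parity q = c -> p != q -> 1 < #|I|.-1.
  move=> pD qD pC qC pc qc pq; rewrite ltn_predRL; apply: leq_ltn_trans (few c).
  by apply/card_gt1P; exists p, q; rewrite !in_set pD qD pC qC pc qc eqxx.
have [i iI] : exists i, i \in I by apply/card_gt0P.
case: (eqVneq (I :\ i) set0) => [Ii | /set0Pn[j jI]].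
  have Ei l : l \in I -> l = i.
    by move=> lI; apply/eqP; move/setP/(_ l): Ii; rewrite !inE lI andbT => /negbFE.
  case: (eqVneq (tnth x i) (tnth y i)) => xyi.
    by rewrite (cube_eq xC yC) // => l /Ei ->.
  suff E : y = flip i x by rewrite E in yA *; apply: connect_flip.
  apply: (cube_eq yC) => [|l /Ei ->]; first by rewrite cube_flip.
  by rewrite tnth_flip eqxx; move: xyi; case: (tnth x i); case: (tnth y i).
move: jI; rewrite !inE => /andP[ji jI].
have EI l : l \in I -> l = i \/ l = j.
  move=> lI; case: (eqVneq l i) => [|li]; first by left.
  case: (eqVneq l j) => [|lj]; [by right | exfalso].
  have : #|[set l; i; j]| <= #|I|.
    by apply/subset_leq_card/subsetP => z; rewrite !inE => /orP[/orP[]|] /eqP ->.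
  by rewrite -setUA cardsU1 cards2 !inE negb_or li lj (eq_sym i) ji /= => /leq_trans/(_ I2).
have fA l z : l \in I -> z \in cube I b -> flip l z \in cube I b by move=> lI; rewrite cube_flip.
have step l : l \in I -> flip l x \notin D -> connect (induced (cube I b :\: D)) x (flip l x).
  by move=> lI lD; apply: connect_flip; rewrite // in_setD lD fA.
case: (eqVneq (tnth x i) (tnth y i)) => xyi; case: (eqVneq (tnth x j) (tnth y j)) => xyj.
- by rewrite (cube_eq xC yC) // => l /EI[] ->.
- have E : y = flip j x.
    apply: (cube_eq yC) => [|l /EI[] ->]; rewrite ?fA // tnth_flip ?eqxx 1?eq_sym ?(negPf ji) ?addbF //.
    by move: xyj; case: (tnth x j); case: (tnth y j).
  by rewrite E; apply: step => //; rewrite -E.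
- have E : y = flip i x.
    apply: (cube_eq yC) => [|l /EI[] ->]; rewrite ?fA // tnth_flip ?eqxx ?(negPf ji) ?addbF //.
    by move: xyi; case: (tnth x i); case: (tnth y i).
  by rewrite E; apply: step => //; rewrite -E.
have E : y = flip i (flip j x).
  apply: (cube_eq yC) => [|l /EI[] ->]; rewrite ?fA ?fA // !tnth_flip ?eqxx.
    by rewrite eq_sym (negPf ji); move: xyi; case: (tnth x i); case: (tnth y i).
  by rewrite (negPf ji); move: xyj; case: (tnth x j); case: (tnth y j).
have via l m : l \in I -> m \in I -> flip m (flip l x) = y -> flip l x \notin D ->
    connect (induced (cube I b :\: D)) x y.
  move=> lI mI Ey lD; apply: connect_trans (step l lI lD) _.
  by rewrite -Ey; apply: connect_flip; rewrite ?Ey // in_setD lD fA.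
case: (boolP (flip j x \in D)) => jD; last by apply: (via j i).
case: (boolP (flip i x \in D)) => iD; last by apply: (via i j); rewrite // flipC.
(* With both ways between opposite corners of the square blocked, two vertices of the same parity
   are deleted. *)
have := two (~~ parity x) _ _ jD iD (fA j x jI xC) (fA i x iI xC).
rewrite !parity_flip flip_eq ltn_predRL ltnNge I2 => /(_ erefl erefl ji).
by [].
Qed.

End BalancedDeletion.

(** * Disconnecting deletions of [2n - 2] vertices *)

Section EdgeNeighbourhood.
Variable n : nat.
Implicit Types (x y z v b : n.-tuple bool) (l i j : 'I_n).
Implicit Types (I : {set 'I_n}) (A B D : {set n.-tuple bool}).

(** Adjacent vertices have opposite parities, so they come from different ends of the edge;
    coordinate [j] then shows that they differ in direction [j]. *)
Lemma edge_neighbours_matching D x j :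
    (forall t, t \in D -> exists l z, [/\ l != j, z = x \/ z = flip j x & t = flip l z]) ->
  forall p q q', p \in D -> q \in D -> q' \in D -> cube_adj p q -> cube_adj p q' -> q = q'.
Proof.
move=> HD.
suff H p q : p \in D -> q \in D -> cube_adj p q -> q = flip j p.
  by move=> p q q' pD qD q'D /H -> // /H ->.
move=> /HD[l [z [lj zx ->]]] /HD[m [w [mj wx ->]]] /cube_adjP[a E].
have Ew : w = flip j z.
  have : parity w != parity z.
    by have := congr1 (@parity n) E; rewrite !parity_flip; case: (parity w); case: (parity z).
  by case: zx wx => -> [] ->; rewrite ?eqxx // flipK.
have := congr1 (fun y : n.-tuple bool => tnth y j) E.
rewrite Ew !tnth_flip eqxx !(eq_sym j) (negPf lj) (negPf mj) !addbF => /addbI/esym/eqP aj.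
by rewrite -Ew E aj.
Qed.

(** [conn_balanced] forces [#|D| = 2 * n.-1], so the set of [obstruction] is all of [D]. It then
    remains to exclude mirror images other than those of the two ends of the edge, which makes [D]
    the neighbourhood of that edge. *)
Lemma disconnected_matching D : 2 < n ->
    (forall c, #|side D c| < n) -> ~ conn (~: D) ->
  forall p q q', p \in D -> q \in D -> q' \in D -> cube_adj p q -> cube_adj p q' -> q = q'.
Proof.
move=> n2 few nconn.
have cI : #|[set: 'I_n]| = n by rewrite cardsT card_ord.
pose b : n.-tuple bool := [tuple false | _ < n].
have CE : D :&: cube setT b = D by rewrite cubeT setIT.
have CE' : cube setT b :\: D = ~: D by rewrite cubeT setTD.
have few' c : #|side (D :&: cube setT b) c| < #|[set: 'I_n]| by rewrite CE cI.
have cD : #|D| = 2 * n.-1.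
  apply/eqP; rewrite eqn_leq; apply/andP; split.
    rewrite -(card_side D true) mul2n -addnn; apply: leq_add; rewrite -ltnS prednK ?few //; exact: ltn_trans n2.
  rewrite leqNgt; apply/negP => small; apply: nconn; rewrite -CE'; apply: conn_balanced => //.
    by rewrite cI; apply: ltn_trans n2.
  by move=> _; rewrite cI CE; move: n2 small; clear; lia.
have I2 : 2 < #|[set: 'I_n]| by rewrite cI.
have [i [v [iI vC few1 tot1]]] := good_half I2 few'.
have cIi : #|setT :\ i| = n.-1 by rewrite -[in RHS]cI [in RHS](cardsD1 i) iI.
have cH : conn (cube (setT :\ i) v :\: D).
  by apply: conn_balanced => //; rewrite cIi; move: n2; clear; lia.
have [x [y [xA yA nxy]]] : exists x y, [/\ x \in cube setT b :\: D, y \in cube setT b :\: D &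
    ~~ connect (induced (cube setT b :\: D)) x y].
  rewrite CE'; case: (boolP [exists x, exists y, [&& x \in ~: D, y \in ~: D &
    ~~ connect (induced (~: D)) x y]]) => [/existsP[x /existsP[y /and3P H]] | H].
    by exists x, y.
  case: nconn => x y xD yD; apply: contraNT H => nxy.
  by apply/existsP; exists x; apply/existsP; exists y; rewrite xD yD.
have [x0 [j [T [x0A jI jD far [TD cT HT]]]]] := obstruction iI vC cH few' xA yA nxy.
have ET : T = D by apply/eqP; rewrite eqEcard -[in X in T \subset X]CE TD cD cT cIi leqnn.
have ji : j != i by move: jI; rewrite !inE => /andP[].
rewrite CE' in x0A xA yA nxy far.
have x0D : x0 \notin D by rewrite -in_setC.
have jA : flip j x0 \in ~: D by rewrite in_setC.
have flipA l z : z \in ~: D -> connect (induced (~: D)) x0 z -> flip l z \notin D ->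
    connect (induced (~: D)) x0 (flip l z).
  by move=> zA xz lD; apply: connect_trans xz _; apply: connect_flip; rewrite // in_setC.
suff inD l z : l != i -> l != j -> z = x0 \/ z = flip j x0 -> flip l z \in D.
  apply: (edge_neighbours_matching (x := x0) (j := j)) => t tD.
  have := tD; rewrite -{1}ET => /HT[l [z [lI zx tE]]].
  have li : l != i by move: lI; rewrite !inE => /andP[].
  (* For [l = j] the vertex [flip l z] is the other end of the edge, which survives; so [t] is the
     mirror image of that end, its neighbour in direction [i]. *)
  case: (eqVneq l j) tE => [-> | lj] tE.
    exists i, (flip j z); split; first by rewrite eq_sym.
      by case: zx => ->; [right | left; rewrite flipK].
    case: tE => [tE|[_ //]]; exfalso; move: tD; rewrite tE.
    by case: zx => ->; rewrite ?flipK; apply/negP.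
  exists l, z; split=> //; case: tE => // -[]; by rewrite inD.
move=> li lj zx; apply/idPn => lD.
have [xz zA] : connect (induced (~: D)) x0 z /\ z \in ~: D.
  by case: zx => ->; split=> //; apply: connect_flip.
have xz' : connect (induced (~: D)) x0 (flip j z).
  by case: zx => ->; rewrite ?flipK //; apply: connect_flip.
have xp := flipA l z zA xz lD.
(* With a fourth direction [m], the vertex [flip m (flip l z)] or its mirror image is deleted. Apart
   from [i] and [j] it differs from the edge in two coordinates, whereas members of [T] differ in at
   most one. *)
case: (boolP [exists m, m \notin [:: i; j; l]]) => [/existsP[m] | /existsPn all3].
  rewrite !inE !negb_or => /and3P[mi mj ml].
  have [t tD tE] : exists2 t, t \in D & t = flip m (flip l z) \/ t = flip i (flip m (flip l z)).
    case: (boolP (flip m (flip l z) \in D)) => mD; first by exists (flip m (flip l z)); auto.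
    exists (flip i (flip m (flip l z))); last by right.
    by apply: (proj1 (far _ _)); apply: flipA => //; rewrite in_setC.
  move: tD; rewrite -ET => /HT[l3 [z3 [_ z3x]]] tE3.
  have z3E a : a != j -> tnth z3 a = tnth z a.
    by case: z3x zx => -> [] -> aj; rewrite ?tnth_flip ?(negPf aj) ?addbF.
  have tz a : a != i -> a != j -> tnth t a = tnth z a (+) (a == m) (+) (a == l).
    move=> ai aj; case: tE => ->; rewrite !tnth_flip ?(negPf ai) ?addbF addbAC //.
  have tz3 a : a != i -> a != j -> tnth t a = tnth z a (+) (a == l3).
    move=> ai aj; rewrite -z3E //; case: tE3 => [|[_]] ->; rewrite !tnth_flip ?(negPf ai) ?addbF //.
  have := tz l li lj; rewrite tz3 // eqxx (eq_sym l m) (negPf ml) addbF => /addbI/eqP l_l3.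
  have := tz m mi mj; rewrite tz3 // eqxx (negPf ml) addbF => /addbI/eqP m_l3.
  by rewrite m_l3 -l_l3 eqxx in ml.
have all3' m : [\/ m = i, m = j | m = l].
  by have := all3 m; rewrite negbK !inE => /or3P[] /eqP; [constructor 1|constructor 2|constructor 3].
have n3 : n <= 3.
  rewrite -[X in X <= _](card_ord n) -cardsT cardE.
  apply: (@uniq_leq_size _ _ [:: i; j; l]) (enum_uniq _) _ => m _; have := all3 m; by rewrite negbK.
(* Now [n = 3]. If this vertex is deleted, so are the mirror images of [flip j z] and [flip l z]:
   three vertices of the same parity. *)
case: (boolP (flip l (flip j z) \in D)) => qD.
  have := few (parity z); rewrite ltnNge; case/negP; apply: leq_trans n3 _.
  apply/card_gt2P; exists (flip l (flip j z)), (flip i (flip j z)), (flip i (flip l z)).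
  have injf m := inj_eq (inv_inj (@flipK n m)).
  split; split; first 1 last.
  - by rewrite !inE !parity_flip negbK eqxx andbT (proj1 (far _ xz')).
  - by rewrite !inE !parity_flip negbK eqxx andbT (proj1 (far _ xp)).
  - by rewrite flip_eq.
  - by rewrite injf flip_eq eq_sym.
  - by rewrite flipC injf flip_eq eq_sym.
  by rewrite !inE !parity_flip negbK eqxx andbT.
(* The face at [z] in directions [j] and [l] survives inside the component of [x0], so its mirror
   image is deleted and nothing else survives. *)
have all t : t \in ~: D -> connect (induced (~: D)) x0 t.
  move=> tD.
  pose fix_at m w := if tnth t m == tnth w m then w else flip m w.
  have fixE m w : tnth (fix_at m w) m = tnth t m.
    rewrite /fix_at; case: (eqVneq (tnth t m) (tnth w m)) => [-> // |].
    by rewrite tnth_flip eqxx; case: (tnth t m); case: (tnth w m).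
  have fix_off m w a : a != m -> tnth (fix_at m w) a = tnth w a.
    by rewrite /fix_at; case: ifP => // _ am; rewrite tnth_flip (negPf am) addbF.
  pose u := fix_at j (fix_at l z).
  have xu : connect (induced (~: D)) x0 u.
    rewrite /u /(fix_at l); case: ifP => _; rewrite /fix_at; case: ifP => _ //.
    rewrite flipC; apply: flipA => //; rewrite in_setC.
    by case: zx => ->; rewrite ?flipK.
  have tu : t = u \/ t = flip i u.
    have uj : tnth u j = tnth t j by apply: fixE.
    have ul : tnth u l = tnth t l by rewrite fix_off.
    case: (eqVneq (tnth t i) (tnth u i)) => tui; [left | right].
      by apply: eq_from_tnth => m; case: (all3' m) => ->; rewrite ?uj ?ul.
    apply: eq_from_tnth => m; rewrite tnth_flip; case: (all3' m) => ->.
    - by rewrite eqxx; move: tui; case: (tnth t i); case: (tnth u i).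
    - by rewrite uj (negPf ji) addbF.
    - by rewrite ul (negPf li) addbF.
  case: tu tD => -> //; rewrite in_setC => /negP[].
  exact: (proj1 (far _ _)).
by case/negP: nxy; apply: (@connect_trans _ _ x0); [rewrite induced_sym|]; apply: all.
Qed.
End EdgeNeighbourhood.

(** * Deleting faces *)

Section FaceDeletion.
Variable n : nat.
Implicit Types (x y z v b p q : n.-tuple bool) (l i j a c : 'I_n).
Implicit Types (I : {set 'I_n}) (A B D C : {set n.-tuple bool}).
Implicit Types (F : {set {set n.-tuple bool}}).

Lemma card_cube I b : #|cube I b| = 2 ^ #|I|.
Proof.
pose f (S : {set 'I_n}) : n.-tuple bool := [tuple tnth b j (+) (j \in S) | j < n].
have fi : injective f.
  move=> S S' E; apply/setP => l.
  have := congr1 (fun y : n.-tuple bool => tnth y l) E.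
  by rewrite !tnth_mktuple => /addbI.
rewrite -card_powerset -(card_imset _ fi); apply: eq_card => x.
apply/idP/imsetP => [/cubeP xb | [S]]; last first.
  rewrite powersetE => /subsetP SI ->; apply/cubeP => l lI; rewrite tnth_mktuple.
  by rewrite (contraNF (SI l) lI) addbF.
exists [set l | tnth x l != tnth b l].
  rewrite powersetE; apply/subsetP => l; rewrite inE; apply: contraR => lI; apply/eqP; exact: xb.
apply: eq_from_tnth => l; rewrite tnth_mktuple inE.
by case: (tnth x l); case: (tnth b l).
Qed.

Lemma card_setD2 I a c : #|I| <= #|I :\ a :\ c| + 2.
Proof.
rewrite (cardsD1 a I) (cardsD1 c (I :\ a)) addnA addnC leq_add2l.
by case: (a \in I); case: (c \in _).
Qed.

Definition face p a c : {set n.-tuple bool} :=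
  [set p; flip a p; flip c p; flip c (flip a p)].

Lemma card_face p a c : #|face p a c| <= 4.
Proof.
by rewrite /face !cardsU !cards1; lia.
Qed.

Lemma face_const p a c l x : l != a -> l != c -> x \in face p a c -> tnth x l = tnth p l.
Proof.
move=> la lc; rewrite !inE => /orP[/orP[/orP[]|]|] /eqP -> //;
by rewrite !tnth_flip ?(negPf la) ?(negPf lc) ?addbF.
Qed.

Lemma face_flip p a c l x : l = a \/ l = c -> x \in face p a c -> flip l x \in face p a c.
Proof.
case=> ->; rewrite !inE => /orP[/orP[/orP[]|]|] /eqP ->;
by rewrite ?flipK ?eqxx ?orbT // 1?flipC ?flipK eqxx ?orbT.
Qed.

Lemma face_dir p a c l x y : x \in face p a c -> y \in face p a c -> tnth x l != tnth y l ->
  l = a \/ l = c.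
Proof.
move=> xF yF; case: (eqVneq l a) => [|la]; first by left.
case: (eqVneq l c) => [|lc]; first by right.
by rewrite (face_const la lc xF) (face_const la lc yF) eqxx.
Qed.

Definition hits F C := [set A in F | A :&: C != set0].

Lemma in_cover F x : reflect (exists2 A, A \in F & x \in A) (x \in cover F).
Proof. exact: bigcupP. Qed.

(** Cut in a direction [i] that is not a direction of some deleted face [A]. The half of [v] misses
    [A], so it meets fewer faces and is connected by induction; every other survivor must then be
    led into it. *)
Lemma conn_faces F I b : (forall A, A \in F -> exists p a c, A = face p a c) ->
  #|hits F (cube I b)| + 3 <= #|I| -> conn (cube I b :\: cover F).
Proof.
move=> HF; move: {2}#|I| (leqnn #|I|) => d; elim: d I b => [|d IH] I b dI hI.
  by move: dI hI; clear; lia.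
case: (set_0Vmem (hits F (cube I b))) => [h0 | [A]].
  have D0 : cover F :&: cube I b = set0.
    apply/setP => x; rewrite in_set0 in_setI; apply/andP => -[/in_cover[A AF xA] xC].
    have : A \in hits F (cube I b) by rewrite inE AF; apply/set0Pn; exists x; rewrite inE xA.
    by rewrite h0 in_set0.
  apply: conn_balanced; rewrite ?D0 ?cards0 //; first by move: hI; clear; lia.
  move=> c; apply: leq_ltn_trans (_ : _ <= 0) _; last by move: hI; clear; lia.
  by rewrite leqn0 cards_eq0; apply/eqP/setP => z; rewrite !inE.
move=> Ah; have := Ah; rewrite !inE => /andP[AF /set0Pn[q]]; rewrite inE => /andP[qA qC].
have [p [a [c EA]]] := HF A AF.
have h1 : 0 < #|hits F (cube I b)| by apply/card_gt0P; exists A.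
(* At least one face is met, so [#|I|] is at least 4 and exceeds the two directions of [A]. *)
have [i iI [ia ic]] : exists2 i, i \in I & i != a /\ i != c.
  have : 0 < #|I :\ a :\ c|.
    by have := leq_trans hI (card_setD2 I a c); move: h1; clear; lia.
  by case/card_gt0P => i; rewrite !inE => /and3P[ic ia iI]; exists i.
have cI : #|I| = #|I :\ i|.+1 by rewrite (cardsD1 i) iI.
pose v := flip i q.
have vC : v \in cube I b by rewrite cube_flip.
have vi : tnth v i = ~~ tnth q i by rewrite tnth_flip eqxx addbT.
have Hq x : (x \in cube (I :\ i) q) = (x \in cube I b) && (tnth x i == tnth q i) := in_half _ qC iI.
have Hv x : (x \in cube (I :\ i) v) = (x \in cube I b) && (tnth x i == tnth v i) := in_half _ vC iI.
have hsub w : w \in cube I b -> hits F (cube (I :\ i) w) \subset hits F (cube I b).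
  move=> wC; apply/subsetP => B; rewrite !inE => /andP[-> /set0Pn[x]].
  rewrite inE => /andP[xB xH]; apply/set0Pn; exists x; rewrite inE xB.
  exact: (subsetP (half_sub i wC)).
have conn_half w B : w \in cube I b -> B \in hits F (cube I b) -> B \notin hits F (cube (I :\ i) w) ->
    conn (cube (I :\ i) w :\: cover F).
  move=> wC Bh Bw; have pr : hits F (cube (I :\ i) w) \proper hits F (cube I b).
    by rewrite properE hsub //; apply/subsetPn; exists B.
  by apply: IH; move: (proper_card pr) dI hI; rewrite cI; clear; lia.
have cv : conn (cube (I :\ i) v :\: cover F).
  apply: (conn_half _ A) => //; rewrite inE negb_and; apply/orP; right.
  apply/negPn/eqP/setP => x; rewrite in_setI in_set0; apply/andP => -[xA].
  rewrite Hv vi => /andP[_]; move: xA qA; rewrite EA => xA qA.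
  by rewrite (face_const ia ic xA) (face_const ia ic qA); case: (tnth p i).
set A' := cube I b :\: cover F.
have Hsub w : w \in cube I b -> cube (I :\ i) w :\: cover F \subset A'.
  by move=> wC; apply: setSD; apply: half_sub.
suff toV x : x \in A' -> exists2 y, connect (induced A') x y & y \in cube (I :\ i) v :\: cover F.
  move=> x y /toV[x' xx' x'v] /toV[y' yy' y'v].
  apply: connect_trans xx' _; rewrite induced_sym; apply: connect_trans yy' _.
  by apply: induced_sub (Hsub v vC) _; apply: cv.
move=> xA'; have [xD xC] : x \notin cover F /\ x \in cube I b by move: xA'; rewrite in_setD => /andP[].
case: (boolP (x \in cube (I :\ i) v)) => xv.
  by exists x; rewrite ?connect0 // in_setD xD.
have xq : x \in cube (I :\ i) q.
  by move: xv; rewrite Hq Hv xC vi /=; case: (tnth x i); case: (tnth q i).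
have fv z : z \in cube (I :\ i) q -> flip i z \in cube (I :\ i) v.
  rewrite Hq Hv cube_flip // => /andP[-> /eqP zq] /=.
  by rewrite tnth_flip eqxx vi addbT zq.
(* If each face that meets the half of [v] also meets the half of [q], it is symmetric in direction
   [i], and the mirror image of [x] survives with [x]. Otherwise the half of [q] meets fewer faces
   too and is connected by induction, so one surviving edge across the cut is enough. *)
case: (boolP (hits F (cube (I :\ i) v) \subset hits F (cube (I :\ i) q))) => [sub|/subsetPn[B Bv Bq]].
  suff fD : flip i x \notin cover F.
    exists (flip i x); last by rewrite in_setD fD fv.
    by apply: connect_flip; rewrite ?xA' // in_setD fD cube_flip.
  apply: contra xD => /in_cover[B BF xB].
  have : B \in hits F (cube (I :\ i) q).
    apply: (subsetP sub); rewrite inE BF; apply/set0Pn; exists (flip i x).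
    by rewrite inE xB fv.
  rewrite inE => /andP[_ /set0Pn[w]]; rewrite inE => /andP[wB].
  move: xq; rewrite !Hq => /andP[_ /eqP xqi] /andP[_ /eqP wqi].
  apply/in_cover; exists B => //; have [p' [a' [c' EB]]] := HF B BF.
  rewrite EB in xB wB *; rewrite -(flipK i x); apply: face_flip (xB).
  by apply: (face_dir xB wB); rewrite tnth_flip eqxx xqi wqi; case: (tnth q i).
have cq : conn (cube (I :\ i) q :\: cover F).
  by apply: (conn_half _ B) => //; apply: (subsetP (hsub v vC)).
(* Otherwise each of the [2 ^ (#|I| - 1)] edges across the cut has a deleted end, but the faces
   cover at most [4 * (#|I| - 3)] vertices. *)
have [z zq [zD fD]] : exists2 z, z \in cube (I :\ i) q & z \notin cover F /\ flip i z \notin cover F.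
  case: (boolP [exists z in cube (I :\ i) q, (z \notin cover F) && (flip i z \notin cover F)]).
    by case/exists_inP => z zq /andP[]; exists z.
  move/exists_inPn => none; exfalso.
  pose f z := if z \in cover F then z else flip i z.
  have fi : {in cube (I :\ i) q &, injective f}.
    move=> z z'; rewrite !Hq => /andP[_ /eqP zi] /andP[_ /eqP z'i]; rewrite /f.
    case: ifP => _; case: ifP => _ //; last by move/(inv_inj (@flipK n i)).
      by move=> E; move: zi; rewrite E tnth_flip eqxx z'i; case: (tnth q i).
    by move=> E; move: z'i; rewrite -E tnth_flip eqxx zi; case: (tnth q i).
  have sub : f @: cube (I :\ i) q \subset cover (hits F (cube I b)).
    apply/subsetP => t /imsetP[z zq ->].
    have fC : f z \in cube I b.
      by move: zq; rewrite /f Hq => /andP[zC _]; case: ifP; rewrite ?cube_flip.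
    have /in_cover[B' B'F fB'] : f z \in cover F.
      by have := none z zq; rewrite /f; case: ifP => //= _; rewrite negbK.
    apply/in_cover; exists B' => //; rewrite inE B'F; apply/set0Pn.
    by exists (f z); rewrite inE fB'.
  have := subset_leq_card sub; rewrite card_in_imset // card_cube => le1.
  have le2 : #|cover (hits F (cube I b))| <= #|hits F (cube I b)| * 4.
    apply: leq_trans (leq_card_cover _) _; rewrite -sum_nat_const; apply: leq_sum => B'.
    by rewrite inE => /andP[/HF[p' [a' [c' ->]]] _]; apply: card_face.
  have := leq_trans le1 le2; move: hI h1; rewrite cI; clear.
  move: #|hits _ _| #|_ :\ i| => h e h3 h0 /=; have -> : e = (e - 3) + 3 by lia.
  by rewrite expnD; have := ltn_expl (e - 3) (isT : 1 < 2); lia.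
have xx : connect (induced A') x z.
  by apply: induced_sub (Hsub q qC) _; apply: cq; rewrite in_setD ?xD ?zD.
exists (flip i z); last by rewrite in_setD fD fv.
apply: connect_trans xx _; have zC : z \in cube I b by move: zq; rewrite Hq => /andP[].
by apply: connect_flip; rewrite in_setD ?zD ?fD ?cube_flip.
Qed.
End FaceDeletion.

(** * Subgraphs of a cycle *)

Lemma isomorphic_sym G H : isomorphic G H -> isomorphic H G.
Proof.
case=> f [[g fK gK] fadj]; exists g; split; first by exists f.
by move=> x y; rewrite -fadj !gK.
Qed.

Lemma isomorphic_trans G H J : isomorphic G H -> isomorphic H J -> isomorphic G J.
Proof.
case=> f [fb fadj] [g [gb gadj]]; exists (g \o f); split; first exact: bij_comp.
by move=> x y /=; rewrite gadj fadj.
Qed.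

Lemma sub_edgeP (G : sgraph) (S : subgraph G) x y : (x, y) \in sub_edges S ->
  [/\ adj x y, x \in sub_vertices S, y \in sub_vertices S & (y, x) \in sub_edges S].
Proof.
by have /forallP/(_ x)/forallP/(_ y)/implyP H := sub_wf S; move/H/and4P.
Qed.

Lemma card_graph_of_sub (G : sgraph) (S : subgraph G) : #|graph_of_sub S| = #|sub_vertices S|.
Proof. by rewrite card_sig; apply: eq_card. Qed.

(** Only images of edges of [K] become edges of [S], so the isomorphism holds even if the image
    spans further edges of [G]. *)
Lemma subgraph_image (G H : sgraph) (K : subgraph H) (f : H -> G) :
    {in sub_vertices K &, injective f} ->
    (forall x y, (x, y) \in sub_edges K -> adj (f x) (f y)) ->
  exists S : subgraph G, sub_vertices S = f @: sub_vertices K /\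
    isomorphic (graph_of_sub S) (graph_of_sub K).
Proof.
move=> fi fadj.
pose E := [set (f p.1, f p.2) | p in sub_edges K].
have wf : [forall x, forall y, ((x, y) \in E) ==>
    [&& adj x y, x \in f @: sub_vertices K, y \in f @: sub_vertices K & (y, x) \in E]].
  apply/forallP => x; apply/forallP => y; apply/implyP => /imsetP[[u v] /= uvE [-> ->]].
  have [_ uK vK vuE] := sub_edgeP uvE.
  rewrite fadj // !imset_f //=; by apply/imsetP; exists (v, u).
pose S : subgraph G := @Subgraph G (f @: sub_vertices K, E) wf.
exists S; split=> //; apply: isomorphic_sym.
have fS (x : graph_of_sub K) : f (val x) \in sub_vertices S by apply: imset_f (valP x).
pose g (x : graph_of_sub K) : graph_of_sub S := Sub (f (val x)) (fS x).
exists g; split.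
  apply: inj_card_bij => [x y /(congr1 val) /= E1|].
    by apply: val_inj; apply: fi E1; apply: valP.
  by rewrite !card_graph_of_sub (card_in_imset fi).
move=> x y; rewrite /adj /= /sub_adj /=.
apply/imsetP/idP => [[[u v] uvE [E1 E2]] | xy]; last by exists (val x, val y).
have [_ uK vK _] := sub_edgeP uvE.
by rewrite (fi _ _ (valP x) uK E1) (fi _ _ (valP y) vK E2).
Qed.

Lemma adj_graph_of_sub (G : sgraph) (S : subgraph G) (x y : graph_of_sub S) :
  adj x y = ((val x, val y) \in sub_edges S).
Proof. by []. Qed.

Lemma closed_disconnects (T : finType) (e : rel T) (a : {pred T}) x y :
    symmetric e -> (forall u v, e u v -> u \in a -> v \in a) ->
  x \in a -> y \notin a -> ~~ connect e x y.
Proof.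
move=> es ea xa; apply: contra => xy.
by rewrite -(closed_connect (intro_closed (sym_connect_sym es) ea) xy).
Qed.

(* Deleting the edges leaving two distinct vertices separates them in a cycle. *)
Lemma one_missing_successor k (K : subgraph (cycle_graph k)) (x y : graph_of_sub K) :
    (forall x y : graph_of_sub K, connect (@adj (graph_of_sub K)) x y) ->
    (val x, ordS (val x)) \notin sub_edges K ->
    (val y, ordS (val y)) \notin sub_edges K -> x = y.
Proof.
move=> cK.
wlog xy : x y / (val x : 'I_k) < (val y : 'I_k) => [WL|] xb yb.
  case: (ltngtP (val x : 'I_k) (val y : 'I_k)) => H; first exact: WL.
    by apply/esym; exact: WL.
  by apply/val_inj/val_inj.
(* The arc from just after [x] up to [y] can be left only by the successor edges at [y] and,
   backwards, at [x]; both are missing. *)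
pose a := [pred z : graph_of_sub K | (val x : 'I_k) < (val z : 'I_k) <= (val y : 'I_k)].
have : ~~ connect (@adj (graph_of_sub K)) y x.
  apply: (@closed_disconnects _ _ a); rewrite ?inE ?ltnn ?leqnn ?andbT //.
    exact: adj_sym.
  move=> u v; rewrite adj_graph_of_sub => uv; rewrite !inE => /andP[xu uy].
  have [/andP[_ /orP[/eqP Ev | /eqP Eu]] _ _ vu] := sub_edgeP uv.
    case: (eqVneq (val u) (val y)) => [uyE | nuy].
      by case/negP: yb; rewrite -uyE -Ev.
    have lt : (val u : 'I_k) < (val y : 'I_k) by rewrite ltn_neqAle nuy.
    have -> : (val v : 'I_k) = (val u : 'I_k).+1 :> nat.
      by rewrite Ev /= modn_small //; apply: leq_ltn_trans lt (ltn_ord _).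
    by rewrite lt andbT; apply: leqW.
  have Eu' : (val u : 'I_k) = (val v : 'I_k).+1 :> nat.
    rewrite Eu /=; have := ltn_ord (val v : 'I_k); rewrite leq_eqVlt => /orP[/eqP kE | /modn_small //].
    by move: xu; rewrite Eu /= kE modnn.
  rewrite Eu' ltnS in xu; rewrite Eu' in uy; rewrite (ltnW uy) andbT ltn_neqAle xu andbT.
  apply: contra xb => /eqP/val_inj ->; by rewrite -Eu.
by rewrite cK.
Qed.

(** The successor maps the vertices of colour [c] injectively into the other colour, except for at
    most one vertex whose successor edge is missing. *)
Lemma connected_cycle_sub_balanced k (K : subgraph (cycle_graph k)) (col : graph_of_sub K -> bool) c :
    connected (graph_of_sub K) ->
    (forall x y, adj x y -> col x != col y) ->
  #|[set x | col x == c]| <= #|[set x | col x == ~~ c]| + 1.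
Proof.
move=> [_ cK] colP.
pose bad := [set x : graph_of_sub K | (val x, ordS (val x)) \notin sub_edges K].
(* The default value [x] does not occur outside [bad], where the successor is a vertex of [K]. *)
pose succ (x : graph_of_sub K) : graph_of_sub K := insubd x (ordS (val x)).
rewrite -(cardsID bad) addnC; apply: leq_add; last first.
  apply: leq_trans (subset_leq_card (subsetIr _ _)) _.
  rewrite leqNgt; apply/negP => /card_gt1P[x [y []]]; rewrite !inE => xb yb.
  by rewrite (one_missing_successor cK xb yb) eqxx.
have succE x : x \notin bad -> val (succ x) = ordS (val x) /\ adj x (succ x).
  rewrite inE negbK => xE; have [_ _ sV _] := sub_edgeP xE.
  have E : val (succ x) = ordS (val x) by rewrite /succ val_insubd sV.
  by rewrite adj_graph_of_sub E.
rewrite -(card_in_imset (f := succ)) => [|x y].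
  apply/subset_leq_card/subsetP => z /imsetP[x]; rewrite in_setD => /andP[xb xc] ->.
  move: xc; have := colP _ _ (succE x xb).2; rewrite !inE.
  by case: (col x); case: (col _); case: c.
rewrite !in_setD => /andP[xb _] /andP[yb _] E; apply: val_inj; apply: (@ordS_inj k).
by rewrite -(succE x xb).1 E (succE y yb).1.
Qed.

(** The condition that [substructure_cut] imposes on each member of a family, for the cycle of
    length [k]. *)
Definition cycle_piece k (G : sgraph) (S : subgraph G) :=
  exists K : subgraph (cycle_graph k),
     connected (graph_of_sub K) /\ isomorphic (graph_of_sub S) (graph_of_sub K).

Lemma card_bigcup_leq (I T : finType) (P : {set I}) (A : I -> {set T}) m :
  (forall i, i \in P -> #|A i| <= m) -> #|\bigcup_(i in P) A i| <= #|P| * m.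
Proof.
move=> H; rewrite -sum_nat_const.
elim/big_ind2: _ => [|X a Y b Xa Yb|i /H //]; first by rewrite cards0.
by apply: leq_trans (leq_card_setU _ _) _; apply: leq_add.
Qed.

(** * Pieces of cycles in the hypercube *)

Section Pieces.
Variable n : nat.
Implicit Types (S : subgraph (hypercube n)) (D : {set n.-tuple bool}).

Lemma connP D : reflect (conn D)
  [forall x in D, forall y in D, connect (induced D) x y].
Proof.
apply: (iffP forall_inP) => [H x y xD yD | H x xD].
  by have /forall_inP := H x xD; apply.
by apply/forall_inP => y; apply: H.
Qed.

(** Parity is a proper colouring of the piece. Its two classes differ by at most one and have at
    most [k] vertices together. *)
Lemma side_piece k S c : cycle_piece k S -> #|side (sub_vertices S) c| <= uphalf k.
Proof.
case=> K [cK [f [[g fK gK] fadj]]].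
pose col x := @parity n (val (g x)).
have colP x y : adj x y -> col x != col y.
  rewrite -{1}(gK x) -{1}(gK y) fadj adj_graph_of_sub => /sub_edgeP[/cube_adjP[l E] _ _ _].
  by rewrite /col E parity_flip; case: parity.
have side_col c' : #|side (sub_vertices S) c'| = #|[set x | col x == c']|.
  have vi : injective (fun x => val (g x)) by move=> x y /val_inj/(can_inj gK).
  rewrite -(card_imset _ vi); apply: eq_card => z; apply/idP/imsetP => [|[x]].
    rewrite inE => /andP[zS zc]; exists (f (Sub z zS)); last by rewrite fK.
    by rewrite inE /col fK.
  by rewrite inE => xc ->; rewrite inE xc andbT; apply: valP.
have := connected_cycle_sub_balanced c cK colP.
have : #|[set x | col x == c]| + #|[set x | col x == ~~ c]| <= k.
  rewrite -!side_col card_side.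
  have <- : #|{: graph_of_sub S}| = #|sub_vertices S| by rewrite card_sig; apply: eq_card.
  rewrite (bij_eq_card (f := f)); last by exists g.
  by rewrite card_sig; apply: leq_trans (max_card _) _; rewrite card_ord.
rewrite side_col uphalf_half; move: #|_| #|_| => a b; clear; have := odd_double_half k; lia.
Qed.

Lemma matching_piece k S D : cycle_piece k S -> sub_vertices S \subset D ->
    (forall p q q', p \in D -> q \in D -> q' \in D ->
       cube_adj p q -> cube_adj p q' -> q = q') ->
  #|sub_vertices S| <= 2.
Proof.
case=> K [[_ cK] [f [[g fK gK] fadj]]] /subsetP SD HD.
case: (set_0Vmem (sub_vertices S)) => [-> | [p pS]]; first by rewrite cards0.
(* [q] is the partner of [p] in the matching, or [p] itself if there is none; no edge inside [D]
   leaves the pair. *)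
have [q Hq] : exists q, forall z, z \in D ->
    (cube_adj p z -> z = q) /\ (p != q -> cube_adj q z -> z = p).
  case: (boolP [exists q in D, cube_adj p q]) => [/exists_inP[q qD pq] | none].
    exists q => z zD; split=> [pz | _ qz]; first exact: HD (SD _ pS) zD qD pz pq.
    by apply: HD qD zD (SD _ pS) qz _; rewrite cube_adj_sym.
  exists p => z zD; split=> [pz|]; last by rewrite eqxx.
  by case/exists_inP: none; exists z.
suff sub : sub_vertices S \subset [set p; q].
  by apply: leq_trans (subset_leq_card sub) _; rewrite cards2; case: eqP.
apply/subsetP => z zS; apply/idPn => zpq.
pose a := [pred u | val (g u) \in [set p; q]].
have := @closed_disconnects _ (@adj (graph_of_sub K)) a (f (Sub p pS)) (f (Sub z zS)).
rewrite cK => /(_ _ _ _ _)/negP; case=> //.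
- exact: adj_sym.
- move=> u v uv; have : adj (g u) (g v) by rewrite -fadj !gK.
  rewrite adj_graph_of_sub => /sub_edgeP[E _ vS _].
  have [H1 H2] := Hq _ (SD _ vS); rewrite !inE => /orP[/eqP up|/eqP uq].
    by rewrite -up in H1; rewrite (H1 E) eqxx orbT.
  case: (eqVneq p q) => [pq|pq].
    by rewrite (H1 _) ?eqxx ?orbT // pq -uq.
  by rewrite (H2 pq) ?eqxx // -uq.
- by rewrite !inE fK eqxx.
- by rewrite inE fK.
Qed.

(** The cardinality hypothesis leaves two vertices, since an empty or one-vertex remainder also
    counts as separated. *)
Lemma conn_not_separating (F : {set subgraph (hypercube n)}) :
    conn (~: family_vertices F : {set n.-tuple bool}) ->
    #|family_vertices F| + 2 <= 2 ^ n -> ~ separating F.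
Proof.
set X := family_vertices F => cX lX.
have cD : #|delete X| = 2 ^ n - #|X|.
  rewrite card_sig -[X in X - _](_ : #|{: n.-tuple bool}| = 2 ^ n); last first.
    by rewrite card_tuple card_bool.
  by rewrite -(cardsC X) addKn; apply: eq_card => z; rewrite !inE.
case; last by rewrite /trivial_graph -/X cD; move: lX; clear; lia.
case; split; first by rewrite -/X cD; move: lX; clear; lia.
have lift p (x y : delete X) : path (@induced n (~: X)) (val x) p -> last (val x) p = val y ->
    connect (@adj (delete X)) x y.
  elim: p x => [|z p IH] x /=; first by move=> _ /val_inj ->; apply: connect0.
  case/andP => /and3P[_ zX xz] pz lz; rewrite in_setC in zX.
  apply: (@connect_trans _ _ (Sub z zX)); first exact: connect1.
  exact: IH.
have inX (x : delete X) : val x \in ~: X by rewrite in_setC; exact: (valP x).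
move=> x y; have /connectP[p pp lp] := cX _ _ (inX x) (inX y).
exact: lift pp (esym lp).
Qed.

(** A disconnecting union would have more than [2 * n - 3] vertices by [conn_balanced] and induce a
    matching. Each piece would then have at most two vertices, and as [2 <= uphalf k] there would be
    fewer than [n] in all. *)
Lemma few_pieces_not_separating k (F : {set subgraph (hypercube n)}) : 2 < n -> 2 < k ->
  (forall S, S \in F -> cycle_piece k S) -> #|F| * uphalf k < n -> ~ separating F.
Proof.
move=> n2 k2 FP Fn.
set D : {set n.-tuple bool} := family_vertices F.
have few c : #|side D c| < n.
  apply: leq_ltn_trans Fn.
  have -> : side D c = \bigcup_(S in F) side (sub_vertices S) c.
    apply/setP => z; rewrite inE; apply/andP/bigcupP => [[/bigcupP[S SF zS] zc] | [S SF]].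
      by exists S; rewrite // inE zS.
    by rewrite inE => /andP[zS ->]; split=> //; apply/bigcupP; exists S.
  by apply: card_bigcup_leq => S /FP; apply: side_piece.
have cD : #|D| <= 2 * n.-1.
  by rewrite -(card_side D true); move: (few true) (few false) => /=; clear; lia.
apply: conn_not_separating; last first.
  have -> : 2 ^ n = 2 * 2 ^ n.-1 by rewrite -expnS prednK //; apply: ltn_trans n2.
  apply: (@leq_trans (2 * n.-1 + 2)); first by rewrite leq_add2r.
  by have := ltn_expl n.-1 (isT : 1 < 2); move: n2; clear; lia.
apply/connP/idPn => /connP nconn; have match_ := disconnected_matching n2 few nconn.
have : #|D| <= #|F| * 2.
  apply: card_bigcup_leq => S SF; apply: matching_piece match_; first exact: FP.
  exact: bigcup_sup.
suff : 2 * n - 3 < #|D|.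
  have : 2 <= uphalf k by rewrite uphalf_half; have := odd_double_half k; move: k2; clear; lia.
  move: Fn n2; clear; move: #|F| #|D| (uphalf k) => a b c; nia.
rewrite ltnNge; apply/negP => small; case: nconn.
pose b : n.-tuple bool := [tuple false | _ < n].
rewrite -setTD -(cubeT b); apply: conn_balanced; rewrite ?cubeT ?setTI ?setIT ?cardsT ?card_ord //.
exact: ltn_trans n2.
Qed.

End Pieces.

Arguments cycle_adj : simpl never.

(** * Paths and cycles as subgraphs *)

Section Arc.
Variables (k t : nat) (full : bool).

(** The flag [full] admits the closing edge between [k - 1] and [0]. Without it this is a path on
    [t] vertices; with it and [t = k] it is the whole cycle. *)
Definition arc_data : {set cycle_graph k} * {set cycle_graph k * cycle_graph k} :=
  ([set i : 'I_k | i < t],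
   [set p : 'I_k * 'I_k | [&& cycle_adj p.1 p.2, p.1 < t, p.2 < t &
      [|| full, p.2 == p.1.+1 :> nat | p.1 == p.2.+1 :> nat]]]).

Lemma arc_wf : [forall x, forall y, ((x, y) \in arc_data.2) ==>
     [&& adj x y, x \in arc_data.1, y \in arc_data.1 & (y, x) \in arc_data.2]].
Proof.
apply/forallP => x; apply/forallP => y; apply/implyP; rewrite !inE /=.
move=> /and4P[xy xt yt f]; rewrite (cycle_adj_sym y x) xy xt yt /=.
by move: f; rewrite orbCA orbC orbA.
Qed.

Definition arc := Subgraph arc_wf.

Lemma arc_connected : 0 < t <= k -> connected (graph_of_sub arc).
Proof.
case/andP => t0 tk; split.
  rewrite card_graph_of_sub; apply/card_gt0P; exists (Ordinal (leq_trans t0 tk)).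
  by rewrite inE.
have arcV m (mt : m < t) : Ordinal (leq_trans mt tk) \in sub_vertices arc by rewrite inE.
pose pt m (mt : m < t) : graph_of_sub arc := Sub (Ordinal (leq_trans mt tk)) (arcV m mt).
have from0 m (mt : m < t) : connect (@adj (graph_of_sub arc)) (pt 0 t0) (pt m mt).
  elim: m mt => [|m IH] mt.
    by rewrite (bool_irrelevance mt t0) connect0.
  apply: connect_trans (IH (ltnW mt)) _; apply: connect1.
  rewrite adj_graph_of_sub inE /= mt (ltnW mt) eqxx orbT !andbT /cycle_adj.
  rewrite -val_eqE /= neq_ltn ltnSn -[_ == ordS _]val_eqE /=.
  by rewrite modn_small ?eqxx // (leq_trans mt tk).
have ptE (x : graph_of_sub arc) : exists m mt, x = pt m mt.
  have xt : (val x : 'I_k) < t by have := valP x; rewrite inE.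
  by exists (val x : 'I_k), xt; apply/val_inj/val_inj.
move=> x y; have [m [mt ->]] := ptE x; have [m' [mt' ->]] := ptE y.
apply: connect_trans (from0 m' mt').
by rewrite sym_connect_sym; last exact: adj_sym.
Qed.

End Arc.

Lemma full_arc_isomorphic k : isomorphic (graph_of_sub (arc k k true)) (cycle_graph k).
Proof.
have inV (i : 'I_k) : i \in sub_vertices (arc k k true) by rewrite inE ltn_ord.
exists val; split; first by exists (fun i => Sub i (inV i)) => x //; apply: val_inj.
by move=> x y; rewrite adj_graph_of_sub inE /= !ltn_ord !andbT.
Qed.

(** Carries the lower bound for substructure cuts over to structure cuts. *)
Lemma cycle_is_piece k (G : sgraph) (S : subgraph G) : 0 < k ->
  isomorphic (graph_of_sub S) (cycle_graph k) -> cycle_piece k S.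
Proof.
move=> k0 SC; exists (arc k k true); split; first by apply: arc_connected; rewrite k0 leqnn.
by apply: isomorphic_trans SC _; apply/isomorphic_sym/full_arc_isomorphic.
Qed.

Lemma arc_image (T : finType) k (x0 : T) s : size s <= k ->
  (fun i : 'I_k => nth x0 s i) @: [set i : 'I_k | i < size s] = [set x in s].
Proof.
move=> sk; apply/setP => x; rewrite inE; apply/imsetP/idP => [[i] | /(nthP x0)[i si <-]].
  by rewrite inE => si ->; apply: mem_nth.
by exists (Ordinal (leq_trans si sk)); rewrite ?inE.
Qed.

Lemma path_piece k (G : sgraph) (s : seq G) : 0 < size s <= k -> uniq s -> sorted (@adj G) s ->
  exists S : subgraph G, sub_vertices S = [set x in s] /\ cycle_piece k S.
Proof.
case/andP => s0 sk us ss; have [x0 _] : exists x0 : G, true by case: s s0 {sk us ss} => // x; exists x.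
have [|x y|S [SV SK]] := @subgraph_image G (cycle_graph k) (arc k (size s) false) (fun i => nth x0 s (i : 'I_k)).
- move=> x y; rewrite !inE => xs ys /eqP; rewrite nth_uniq // => /eqP; exact: val_inj.
- rewrite inE /= => /and4P[_ xs ys]; have /(sortedP x0) H := ss.
  by case/orP => /eqP E; [|rewrite adj_sym]; rewrite E; apply: H; rewrite -E.
exists S; rewrite SV arc_image //; split=> //.
by exists (arc k (size s) false); split=> //; apply: arc_connected; rewrite s0.
Qed.

Lemma cycle_structure k (G : sgraph) (s : seq G) : 2 < k -> size s = k -> uniq s -> cycle (@adj G) s ->
  exists S : subgraph G, sub_vertices S = [set x in s] /\ isomorphic (graph_of_sub S) (cycle_graph k).
Proof.
move=> k2 sk us cs; have [x0 _] : exists x0 : G, true.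
  by case: s sk {us cs} => [kE|x]; [rewrite -kE in k2 | exists x].
have next_adj i : i < k -> adj (nth x0 s i) (nth x0 s (i.+1 %% k)).
  case: s sk us cs => [kE|x p sk us /(pathP x0) H ik]; first by rewrite -kE in k2.
  rewrite /= in sk; have := H i; rewrite size_rcons sk => /(_ ik).
  rewrite -rcons_cons !nth_rcons /= sk ik; case: (ltngtP i (size p)) => ip.
  - by rewrite modn_small // -sk.
  - by move: ik; rewrite -sk ltnS leqNgt ip.
  - by rewrite -sk ip modnn.
have [|x y|S [SV SK]] := @subgraph_image G (cycle_graph k) (arc k k true) (fun i => nth x0 s (i : 'I_k)).
- move=> x y; rewrite !inE => xs ys /eqP; rewrite nth_uniq ?sk // => /eqP; exact: val_inj.
- rewrite inE /= => /and4P[/andP[_ xy] xs ys _].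
  by case/orP: xy => /eqP ->; [|rewrite adj_sym]; apply: next_adj.
exists S; split; last exact: isomorphic_trans SK (full_arc_isomorphic k).
by rewrite SV -(@arc_image _ k x0) ?sk.
Qed.

(** Opposite edges of a 4-cycle in the cube are parallel: the two routes from [v 0] to [v 2] flip
    the same two directions, in opposite orders because [v 1] and [v 3] differ. *)
Lemma cycle4_face n (S : subgraph (hypercube n)) : isomorphic (graph_of_sub S) (cycle_graph 4) ->
  exists p a c, sub_vertices S = face p a c.
Proof.
case=> f [[g fK gK] fadj].
pose o i : 'I_4 := inord i.
pose v i : n.-tuple bool := val (g (o i)).
have oE i : i < 4 -> (o i : nat) = i by move=> i4; rewrite /o inordK.
have vadj i j : cycle_adj (o i) (o j) -> exists l, v j = flip l (v i).
  move=> ij; apply/cube_adjP.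
  have : adj (g (o i)) (g (o j)) by rewrite -fadj !gK.
  by rewrite adj_graph_of_sub => /sub_edgeP[].
have cadj i : i < 4 -> cycle_adj (o i) (o (i.+1 %% 4)).
  move=> i4; rewrite /cycle_adj -val_eqE /= -[o _ == ordS _]val_eqE /= !oE ?ltn_mod //.
  by case: i i4 => [|[|[|[|]]]].
have [a Ea] := vadj 0 1 (cadj 0 isT).
have [c Ec] := vadj 3 0 (cadj 3 isT).
have [d Ed] := vadj 1 2 (cadj 1 isT).
have [e Ee] := vadj 2 3 (cadj 2 isT).
have vneq i j : i < 4 -> j < 4 -> i != j -> v i != v j.
  move=> i4 j4; apply: contraNneq => /val_inj/(can_inj gK)/(congr1 val).
  by rewrite /= !oE // => ->.
have E3 : v 3 = flip c (v 0) by rewrite Ec flipK.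
have E2 : v 2 = flip c (flip a (v 0)).
  have E2' : v 2 = flip e (flip c (v 0)) by rewrite -E3 Ee flipK.
  rewrite Ed Ea; congr flip => //.
  have ac : a != c.
    by apply: contraTneq (vneq 1 3 isT isT isT) => ac; rewrite Ea E3 ac eqxx.
  have := congr1 (fun y : n.-tuple bool => tnth y c) (etrans (esym E2') (etrans Ed (congr1 (flip d) Ea))).
  rewrite !tnth_flip eqxx (eq_sym c a) (negPf ac) addbF.
  have ec : e != c.
    by apply: contraTneq (vneq 2 0 isT isT isT) => ec; rewrite E2' ec flipK eqxx.
  by rewrite (eq_sym c e) (negPf ec) addbF => /addbI/esym/eqP.
exists (v 0), a, c.
rewrite /face -Ea -E3 Ea -E2 -Ea; apply/setP => z; rewrite !inE.
apply/idP/idP => [zS | ].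
  have -> : z = val (g (f (Sub z zS))) by rewrite fK.
  have : f (Sub z zS) = o (f (Sub z zS)) by apply: ord_inj; rewrite oE ?ltn_ord.
  case: (f _) => m m4 ->; rewrite /= -/(v m).
  by case: m m4 => [|[|[|[|]]]] // _; rewrite eqxx ?orbT.
by move=> /orP[/orP[/orP[]|]|] /eqP ->; apply: valP.
Qed.

Lemma few_faces_not_separating n (F : {set subgraph (hypercube n)}) :
  (forall S, S \in F -> isomorphic (graph_of_sub S) (cycle_graph 4)) ->
  #|F| + 3 <= n -> ~ separating F.
Proof.
move=> FP Fn; pose F' : {set {set n.-tuple bool}} := (@sub_vertices _) @: F.
have F'F : #|F'| <= #|F| by apply: leq_imset_card.
have F'face A : A \in F' -> exists p a c, A = face p a c.
  by case/imsetP => S /FP/cycle4_face H ->.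
have cov : cover F' = family_vertices F by rewrite cover_imset.
apply: conn_not_separating.
  pose b : n.-tuple bool := [tuple false | _ < n].
  rewrite -cov -setTD -(cubeT b); apply: conn_faces => //.
  rewrite cardsT card_ord; apply: leq_trans Fn; rewrite leq_add2r.
  by apply: leq_trans F'F; apply/subset_leq_card/subsetP => A; rewrite inE => /andP[].
(* Two vertices remain because [4 * (n - 3) + 2 <= 2 ^ n]. *)
apply: (@leq_trans (#|F| * 4 + 2)).
  rewrite leq_add2r; apply: card_bigcup_leq => S /FP/cycle4_face[p [a [c ->]]].
  exact: card_face.
move: Fn; clear; move: #|F| => m mn; have -> : n = (n - 3) + 3 by lia.
by rewrite expnD; have := ltn_expl (n - 3) (isT : 1 < 2); lia.
Qed.

(** * Zigzag paths and cycles *)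

(** An upper bound on the cardinality suffices, which suits families built as images, whose members
    may coincide. *)
Lemma min_card_intro (T : finType) (P : {set T} -> Prop) m :
  (exists2 F, P F & #|F| <= m) -> (forall F, P F -> m <= #|F|) -> is_min_card P m.
Proof.
move=> [F PF Fm] H; split=> //; exists F; split=> //.
by apply/eqP; rewrite eqn_leq Fm H.
Qed.

(** Induction on the size of the given set; [P] is an arbitrary proposition, so the case split is
    classical. *)
Lemma min_card_exists (T : finType) (P : {set T} -> Prop) F :
  P F -> exists m, is_min_card P m.
Proof.
move: {2}#|F| (leqnn #|F|) => m; elim: m F => [|m IH] F Fm PF.
  by exists 0; apply: min_card_intro => //; exists F.
case: (classic (exists2 F', P F' & #|F'| <= m)) => [[F' PF' F'm] | none]; first exact: IH F'm PF'.
exists m.+1; apply: min_card_intro; first by exists F.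
by move=> F' PF'; rewrite ltnNge; apply/negP => F'm; apply: none; exists F'.
Qed.

Lemma family_exists (G : sgraph) (I : finType) (A : I -> {set G}) (Q : subgraph G -> Prop) :
    (forall i, exists S, sub_vertices S = A i /\ Q S) ->
  exists F : {set subgraph G}, [/\ forall S, S \in F -> Q S, #|F| <= #|I| &
    family_vertices F = \bigcup_i A i].
Proof.
move=> /fin_all_exists[f fP]; exists (f @: I); split.
- by move=> S /imsetP[i _ ->]; case: (fP i).
- exact: leq_imset_card.
- rewrite /family_vertices; apply/setP => x; apply/bigcupP/bigcupP.
    by case=> _ /imsetP[i _ ->]; rewrite (fP i).1; exists i.
  by case=> i _ xA; exists (f i); rewrite ?imset_f // (fP i).1.
Qed.

Lemma closed_separating (G : sgraph) (F : {set subgraph G}) (B : {pred G}) u v :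
    u \notin family_vertices F -> v \notin family_vertices F -> u \in B -> v \notin B ->
    (forall x y, y \notin family_vertices F -> adj x y -> x \in B -> y \in B) ->
  separating F.
Proof.
move=> uF vF uB vB HB; left=> -[_ H].
have := H (Sub u uF) (Sub v vF); apply/negP.
apply: (@closed_disconnects _ _ [pred x : delete _ | val x \in B]) => //.
  exact: adj_sym.
by move=> x y xy; apply: HB xy; apply: (valP y).
Qed.

(** By convention the empty graph is not connected. *)
Lemma cover_separating (G : sgraph) (F : {set subgraph G}) :
  family_vertices F = setT -> separating F.
Proof.
move=> FT; left=> -[/card_gt0P[[x xF] _] _].
by move: xF; rewrite FT inE.
Qed.

Section Zigzag.
Variable n : nat.
Implicit Types (x y z v b : n.-tuple bool) (l i j : 'I_n).
Implicit Types (I : {set 'I_n}).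

(** Induction on the dimension. A path too long for a half starts from a Hamiltonian path of that
    half, whose first edge is replaced by a detour through the other half; the detour again joins
    two adjacent vertices. *)
Lemma cube_path I j x h : j \in I -> 0 < h -> h.*2 <= 2 ^ #|I| ->
  exists p, [/\ path (@cube_adj n) x p, last x p = flip j x, uniq (x :: p), size p = h.*2.-1
    & {subset x :: p <= cube I x}].
Proof.
move: {2}#|I| (leqnn #|I|) => d; elim: d I j x h => [|d IH] I j x h dI jI h0 hI.
  by move: dI; rewrite leqn0 cards_eq0 => /eqP I0; rewrite I0 inE in jI.
have [h1|h2] := leqP h 1.
  have -> : h = 1 by apply/eqP; rewrite eqn_leq h1.
  exists [:: flip j x]; split=> //=; rewrite ?cube_adj_flip // ?inE 1?eq_sym ?flip_neq //.
  by move=> y; rewrite !inE => /orP[] /eqP ->; rewrite ?cube_flip ?cube_refl.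
have [i iI ij] : exists2 i, i \in I & i != j.
  have : 0 < #|I :\ j|.
    move: hI; rewrite (cardsD1 j) jI; case: #|_ :\ j| => //.
    by rewrite expn1; move: h2; clear; lia.
  by case/card_gt0P => i; rewrite !inE => /andP[ij iI]; exists i.
have cI : #|I| = #|I :\ i|.+1 by rewrite (cardsD1 i) iI.
have jI' : j \in I :\ i by rewrite !inE eq_sym ij.
have dI' : #|I :\ i| <= d by rewrite -ltnS -cI.
have subI w : w \in cube I x -> {subset cube (I :\ i) w <= cube I x}.
  by move=> wx; apply/subsetP/half_sub.
have [hI'|hI'] := leqP h.*2 (2 ^ #|I :\ i|).
  have [p [pp lp up sp Rp]] := IH _ j x h dI' jI' h0 hI'.
  by exists p; split=> // y /Rp; apply: subI; apply: cube_refl.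
have I'0 : 0 < #|I :\ i| by apply/card_gt0P; exists j.
pose h1 := 2 ^ #|I :\ i|.-1.
have h1E : h1.*2 = 2 ^ #|I :\ i| by rewrite -mul2n -expnS prednK.
have h10 : 0 < h1 by rewrite expn_gt0.
have [[|y p1] [pp1 lp1 up1 sp1 Rp1]] := IH _ j x h1 dI' jI' h10 (eq_leq h1E).
  by move: h10 sp1; clear; case: (h1).
have [xy pp1'] : cube_adj x y /\ path (@cube_adj n) y p1 by case/andP: pp1.
have /cube_adjP[j2 Ey] := xy.
have yR : y \in cube (I :\ i) x by apply: Rp1; rewrite inE mem_head orbT.
have j2I : j2 \in I :\ i.
  apply: contraLR yR => j2I; apply/negP => /cubeP/(_ j2 j2I).
  by rewrite Ey tnth_flip eqxx; case: (tnth x j2).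
have h2' : (h - h1).*2 <= 2 ^ #|I :\ i|.
  by move: hI; rewrite cI expnS -h1E; clear; lia.
have h20 : 0 < h - h1 by move: hI'; rewrite -h1E; clear; lia.
have [p2 [pp2 lp2 up2 sp2 Rp2]] := IH _ j2 (flip i x) (h - h1) dI' j2I h20 h2'.
have R1i z : z \in x :: y :: p1 -> tnth z i = tnth x i by move=> /Rp1/half_tnth.
have R2i z : z \in flip i x :: p2 -> tnth z i = ~~ tnth x i.
  by move=> /Rp2/half_tnth ->; rewrite tnth_flip eqxx addbT.
(* From [x] cross to the other half, follow [p2] to the mirror image of [y], cross back to [y] and
   continue along [p1]. *)
exists ((flip i x :: p2) ++ y :: p1); split.
- rewrite cat_path /= cube_adj_flip pp2 lp2 flipC -Ey pp1' andbT.
  by rewrite cube_adj_sym cube_adj_flip.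
- by rewrite last_cat.
- rewrite -cat1s uniq_catCA cat_uniq up2 up1 andbT; apply/hasPn => z z1.
  by apply/negP => z2; have := R2i z z2; rewrite R1i //; case: (tnth x i).
- by rewrite size_cat /= sp2; move: sp1 h20 h10; rewrite /=; clear; lia.
- move=> z; rewrite inE mem_cat => H.
  case: (boolP (z \in flip i x :: p2)) H => [/Rp2 zR _|_].
    by apply: subI zR; rewrite cube_flip ?cube_refl.
  by rewrite /= -in_cons => /Rp1; apply: subI; apply: cube_refl.
Qed.

Lemma cycle_through x h : 0 < n -> 1 < h -> h.*2 <= 2 ^ n ->
  exists s, [/\ size s = h.*2, uniq s, cycle (@cube_adj n) s & x \in s].
Proof.
move=> n0 h1 hn.
have [|p [pp lp up sp _]] := @cube_path setT (Ordinal n0) x h (in_setT _) (ltnW h1).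
  by rewrite cardsT card_ord.
exists (x :: p); split; rewrite ?mem_head //.
  by rewrite /= sp prednK // double_gt0 (ltnW h1).
by rewrite /= rcons_path pp lp cube_adj_sym cube_adj_flip.
Qed.

(* The vertex with support {a, c}; a neighbour of the zero vertex when [a = c]. *)
Definition pair_vertex (a c : nat) : n.-tuple bool :=
  [tuple (j == a :> nat) || (j == c :> nat) | j < n].

Lemma pair_vertexC a c : pair_vertex a c = pair_vertex c a.
Proof. by apply: eq_from_tnth => j; rewrite !tnth_mktuple orbC. Qed.

Lemma pair_vertex_adj a c : c < n -> a != c -> cube_adj (pair_vertex a a) (pair_vertex a c).
Proof.
move=> cn ac; apply/cube_adjP; exists (Ordinal cn); apply: eq_from_tnth => j.
rewrite tnth_flip !tnth_mktuple orbb -val_eqE /=.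
case: (eqVneq (j : nat) a) => [ja|_]; last by case: eqP.
by rewrite ja (negPf ac).
Qed.

Lemma pair_vertex_inj a c a' c' : a < n -> c < n -> a' < n -> c' < n ->
  pair_vertex a c = pair_vertex a' c' -> (a = a' /\ c = c') \/ (a = c' /\ c = a').
Proof.
move=> an cn an' cn' E.
have H m : m < n -> (m == a) || (m == c) = (m == a') || (m == c').
  move=> mn; have := congr1 (fun y : n.-tuple bool => tnth y (Ordinal mn)) E.
  by rewrite !tnth_mktuple.
have := H a an; have := H c cn; have := H _ an'; have := H _ cn'.
by rewrite !eqxx ?orbT; clear; lia.
Qed.

(** Even indices give the neighbours of the zero vertex in directions [s] to [s + r - 1], odd
    indices the pairs between consecutive ones. Reduction modulo [r] gives period [2 * r], so the
    walk closes up. *)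
Definition zigzag (s r i : nat) := pair_vertex (s + i./2 %% r) (s + uphalf i %% r).

Lemma modn_succ_neq r m : 1 < r -> m %% r != m.+1 %% r.
Proof.
move=> r1; rewrite -addn1 -[X in X %% r != _]addn0 eqn_modDl mod0n.
by rewrite modn_small.
Qed.

Lemma zigzag_adj (s r i : nat) : 1 < r -> s + r <= n -> cube_adj (zigzag s r i) (zigzag s r i.+1).
Proof.
move=> r1 sr; have lt m : s + m %% r < n.
  by apply: leq_trans sr; rewrite ltn_add2l ltn_pmod // ltnW.
rewrite /zigzag -[i.+1./2]/(uphalf i) -[uphalf i.+1]/(i./2.+1).
rewrite uphalf_half; case: (odd i); rewrite ?add1n ?add0n; last first.
  by apply: pair_vertex_adj; rewrite ?lt // eqn_add2l modn_succ_neq.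
by rewrite cube_adj_sym [X in cube_adj _ X]pair_vertexC pair_vertex_adj ?lt // eqn_add2l eq_sym modn_succ_neq.
Qed.

(** For [r = 2] the closing pair [{s + 1, s}] repeats [{s, s + 1}], hence the restriction to the
    first [2 * r - 1] terms. *)
Lemma zigzag_inj (s r i i' : nat) : s + r <= n -> i < r.*2 -> i' < r.*2 ->
    2 < r \/ (i < r.*2.-1 /\ i' < r.*2.-1) ->
  zigzag s r i = zigzag s r i' -> i = i'.
Proof.
move=> sr ir ir' H.
have r0 : 0 < r by move: ir; clear; lia.
have lt m : s + m %% r < n by apply: leq_trans sr; rewrite ltn_add2l ltn_pmod.
move/pair_vertex_inj => /(_ (lt _) (lt _) (lt _) (lt _)).
have small m : m < r.*2 -> m./2 %% r = m./2 by move=> mr; rewrite modn_small // ltn_half_double.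
(* Only the last index wraps around. *)
have up m : m < r.*2 -> uphalf m %% r = if m == r.*2.-1 then 0 else uphalf m.
  move=> mr; case: eqP => [->|ne]; last first.
    by rewrite modn_small //; move: ne mr; clear; lia.
  by rewrite (_ : uphalf _ = r) ?modnn //; move: r0; clear; lia.
rewrite !small // !up //; move: H ir ir' r0; clear.
have := odd_double_half i; have := odd_double_half i'; rewrite !uphalf_half.
by case: (odd i); case: (odd i'); case: eqP => /= ?; case: eqP => /= ?; lia.
Qed.

Lemma zigzag_even s r p : p < r -> zigzag s r p.*2 = pair_vertex (s + p) (s + p).
Proof. by move=> pr; rewrite /zigzag doubleK uphalf_double modn_small. Qed.

Lemma zigzag_uniq s r t : s + r <= n -> t <= r.*2 -> 2 < r \/ t < r.*2 ->
  uniq (mkseq (zigzag s r) t).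
Proof.
move=> sr tr H; rewrite map_inj_in_uniq ?iota_uniq // => i i'; rewrite !mem_iota !add0n /= => it it'.
apply: (zigzag_inj sr (leq_trans it tr) (leq_trans it' tr)).
by move: H it it'; clear; lia.
Qed.

Lemma zigzag_sorted s r t : 1 < r -> s + r <= n -> sorted (@cube_adj n) (mkseq (zigzag s r) t).
Proof.
move=> r1 sr; apply/(sortedP (zigzag s r 0)) => i; rewrite size_mkseq => it.
by rewrite !nth_mkseq ?zigzag_adj // ltnW.
Qed.

Lemma zigzag_cycle s r : 1 < r -> s + r <= n -> cycle (@cube_adj n) (mkseq (zigzag s r) r.*2).
Proof.
move=> r1 sr; have := zigzag_sorted (r.*2.+1) r1 sr.
have E : zigzag s r r.*2 = zigzag s r 0.
  by rewrite /zigzag doubleK uphalf_double modnn mod0n.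
rewrite /mkseq -addn1 iotaD map_cat /= add0n E.
case: r.*2 => [|m] //=; by rewrite cats1.
Qed.

End Zigzag.

(** * Cuts *)

Section Cuts.
Variable n : nat.
Implicit Types (F : {set subgraph (hypercube n)}).

Definition zero_vertex : n.-tuple bool := [tuple false | _ < n].

Lemma tnth_zero l : tnth zero_vertex l = false.
Proof. by rewrite tnth_mktuple. Qed.

Lemma flip_zero l : flip l zero_vertex = pair_vertex n l l.
Proof. by apply: eq_from_tnth => j; rewrite tnth_flip !tnth_mktuple orbb. Qed.

Lemma isolating_separating F (v : n.-tuple bool) :
    zero_vertex \notin family_vertices F -> v \notin family_vertices F -> v != zero_vertex ->
    (forall l, flip l zero_vertex \in family_vertices F) ->
  separating F.
Proof.
move=> zF vF vz cov.
apply: (@closed_separating (hypercube n) F [pred x | x == zero_vertex] zero_vertex v) => //.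
  by rewrite inE.
move=> x y yF /cube_adjP[l E]; rewrite !inE => /eqP xz; case/negP: yF.
by rewrite E xz cov.
Qed.

(** Used to exhibit vertices that no zigzag visits. *)
Lemma pair_vertex_two a c (l1 l2 l3 : 'I_n) : l1 != l2 -> l1 != l3 -> l2 != l3 ->
  ~~ [&& tnth (pair_vertex n a c) l1, tnth (pair_vertex n a c) l2 & tnth (pair_vertex n a c) l3].
Proof. by rewrite !tnth_mktuple -!val_eqE /=; lia. Qed.

Lemma zigzag_neq_zero s r (i : nat) : 0 < r -> s + r <= n -> zigzag n s r i != zero_vertex.
Proof.
move=> r0 sr; have lt : s + i./2 %% r < n by apply: leq_trans sr; rewrite ltn_add2l ltn_pmod.
apply/eqP => E; have := congr1 (fun y : n.-tuple bool => tnth y (Ordinal lt)) E.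
by rewrite tnth_zero tnth_mktuple eqxx.
Qed.

(** The directions are covered by [m] windows of length [r]. The first [2 * r - 1] terms of a zigzag
    already contain every neighbour of the zero vertex in its window. *)
Lemma zigzag_family r m t (Q : subgraph (hypercube n) -> Prop) :
    2 < n -> 0 < r <= n -> n <= m * r -> r.*2.-1 <= t ->
    (forall s, s + r <= n -> exists S : subgraph (hypercube n),
       sub_vertices S = ([set x in mkseq (zigzag n s r) t] : {set n.-tuple bool}) /\ Q S) ->
  exists2 F : {set subgraph (hypercube n)}, (forall S, S \in F -> Q S) /\ separating F & #|F| <= m.
Proof.
move=> n2 /andP[r0 rn] nm tr HQ.
(* Windows that would overrun [n] are shifted back to end there. *)
pose s (q : 'I_m) := minn (q * r) (n - r).
have sr q : s q + r <= n by rewrite /s; move: rn; clear; lia.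
have [F [FQ Fm FV]] := family_exists (fun q => HQ _ (sr q)).
rewrite card_ord in Fm; exists F => //; split=> //.
(* The all-ones vertex survives, having at least three nonzero coordinates. *)
pose v : n.-tuple bool := [tuple true | _ < n].
have H x : x \in family_vertices F -> exists q i, x = zigzag n (s q) r i.
  rewrite FV => /bigcupP[q _]; rewrite inE => /mapP[i _ ->]; by exists q, i.
have n0 : 0 < n by apply: ltn_trans n2.
have n1 : 1 < n by apply: ltn_trans n2.
apply: (@isolating_separating F v).
- by apply/negP => /H[q [i /esym/eqP]]; rewrite (negPf (zigzag_neq_zero _ _ _)).
- apply/negP => /H[q [i E]].
  have := @pair_vertex_two (s q + i./2 %% r) (s q + uphalf i %% r) (Ordinal n0) (Ordinal n1) (Ordinal n2) isT isT isT.
  by rewrite -/(zigzag n (s q) r i) -E !tnth_mktuple.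
- apply/eqP => E; have := congr1 (fun y : n.-tuple bool => tnth y (Ordinal n0)) E.
  by rewrite !tnth_mktuple.
move=> l; rewrite FV flip_zero.
have qm : l %/ r < m by rewrite ltn_divLR //; apply: leq_trans nm.
pose q := Ordinal qm.
have [sl lsr] : s q <= l /\ l < s q + r.
  rewrite /s /=; have := divn_eq l r; have := ltn_pmod l r0; have := ltn_ord l.
  by move: rn; clear; move: (l %/ r * r) => w; lia.
apply/bigcupP; exists q => //; rewrite inE; apply/mapP; exists (l - s q).*2.
  rewrite mem_iota add0n /=; move: tr sl lsr; clear; lia.
by rewrite zigzag_even ?subnKC //; move: sl lsr; clear; lia.
Qed.

(** A zigzag path on [2 * r - 1] vertices covers [r] neighbours, and [r = uphalf k] still fits into
    a cycle of length [k]; [r] is capped at [n], the number of directions. *)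
Lemma pieces_cut k m : 2 < n -> 2 < k -> n <= m * uphalf k ->
  exists2 F : {set subgraph (hypercube n)}, (forall S, S \in F -> cycle_piece k S) /\ separating F & #|F| <= m.
Proof.
move=> n2 k2 nm; have k2' : 1 < uphalf k by move: k2; clear; lia.
have kE : (uphalf k).*2.-1 <= k by clear; lia.
pose r := minn (uphalf k) n.
have r1 : 1 < r by rewrite /r leq_min k2' ltnW.
have nmr : n <= m * r.
  rewrite /r /minn; case: ifP => // _; rewrite leq_pmull //.
  by move: nm (n2); clear; case: m => //; rewrite mul0n leqn0 => /eqP ->.
apply: (@zigzag_family r m r.*2.-1) => //; first by rewrite ltnW // geq_minr.
move=> s sr; apply: path_piece.
- by rewrite size_mkseq; move: r1 kE; rewrite /r; clear; lia.
- by apply: zigzag_uniq => //; move: r1; clear; lia.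
- exact: zigzag_sorted.
Qed.

Lemma cycles_cut r m : 2 < n -> 2 < r <= n -> n <= m * r ->
  exists2 F : {set subgraph (hypercube n)}, structure_cut (cycle_graph r.*2) F & #|F| <= m.
Proof.
move=> n2 /andP[r2 rn] nm.
have r1 := ltnW r2.
apply: (@zigzag_family r m r.*2) => //; first by rewrite rn ltnW.
  exact: leq_pred.
move=> s sr; apply: cycle_structure; rewrite ?size_mkseq //.
- by move: r2; clear; lia.
- by apply: zigzag_uniq => //; left.
- exact: zigzag_cycle.
Qed.

(* The zigzag cycle through all neighbours of [zero_vertex], with its edge from
   {0} to {0,1} replaced by a detour through the subcube of the vertices
   containing 0 and 2, which the zigzag avoids. *)
Lemma long_cycle_cut h : 4 < n -> n < h -> h.*2 <= 2 ^ (n - 2) ->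
  exists2 F : {set subgraph (hypercube n)}, structure_cut (cycle_graph h.*2) F & #|F| <= 1.
Proof.
move=> n4 nh hn.
have [n0 n1 n2 n3] : [/\ 0 < n, 1 < n, 2 < n & 3 < n] by split; move: n4; clear; lia.
pose i0 : 'I_n := Ordinal n0; pose i1 : 'I_n := Ordinal n1.
pose i2 : 'I_n := Ordinal n2; pose i3 : 'I_n := Ordinal n3.
(* The detour starts at {0,2}, next to {0}, and ends at {0,1,2}, next to {0,1}. *)
pose x0 := pair_vertex n 0 2.
pose R := cube ([set: 'I_n] :\ i0 :\ i2) x0.
have Rtrue y : y \in R -> tnth y i0 /\ tnth y i2.
  by move=> /cubeP yR; rewrite !yR ?inE ?eqxx ?andbF // !tnth_mktuple.
have [p [pp lp up sp Rp]] : exists p, [/\ path (@cube_adj n) x0 p, last x0 p = flip i1 x0,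
    uniq (x0 :: p), size p = (h - n).*2.-1 & {subset x0 :: p <= R}].
  apply: cube_path; first by rewrite !inE.
    by rewrite subn_gt0.
  apply: leq_trans (_ : 2 ^ (n - 2) <= _); first by move: hn; clear; lia.
  rewrite leq_exp2l //; have := card_setD2 [set: 'I_n] i0 i2.
  by rewrite cardsT card_ord; clear; lia.
pose L := mkseq (zigzag n 0 n) n.*2.
have cL : cycle (@cube_adj n) L by apply: zigzag_cycle.
have uL : uniq L by apply: zigzag_uniq => //; left.
pose w := [seq zigzag n 0 n i | i <- iota 2 (n.*2 - 2)].
have LE : L = pair_vertex n 0 0 :: pair_vertex n 0 1 :: w.
  have iotaE m : 1 < m -> iota 0 m = [:: 0, 1 & iota 2 (m - 2)].
    by case: m => [|[|m]] // _; rewrite /= subn2.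
  rewrite /L /mkseq iotaE; last by move: (n1); clear; lia.
  by rewrite /= /zigzag /= !mod0n !add0n modn_small.
have Lpair y : y \in L -> exists i, i < n.*2 /\ y = zigzag n 0 n i.
  by case/mapP => i; rewrite mem_iota => /andP[_ iL] ->; exists i.
(* A zigzag vertex contains at most two coordinates, cyclically consecutive; 0 and 2 are not
   consecutive modulo [n] when [n > 3]. *)
have LR y : y \in L -> y \notin R.
  move=> /Lpair[i [il ->]]; apply/negP => /Rtrue[].
  have := odd_double_half i; rewrite !tnth_mktuple /= !add0n uphalf_half.
  have i2n : i./2 < n by move: il; clear; lia.
  move: (n3) il i2n; clear => n3 il i2n.
  case: (odd i) => /=; rewrite ?add0n ?add1n !(modn_small i2n); last by clear; lia.
  case: (ltngtP i./2.+1 n) => [lt|gt|E]; [rewrite modn_small // | by move: i2n gt; clear; lia | rewrite E modnn].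
    by clear; lia.
  by move: n3 E; clear; lia.
(* The length is [2 * n] from the zigzag plus [2 * (h - n)] from the detour. *)
pose s := pair_vertex n 0 0 :: (x0 :: p) ++ pair_vertex n 0 1 :: w.
have sE : s = [:: pair_vertex n 0 0] ++ (x0 :: p) ++ pair_vertex n 0 1 :: w by [].
have sP y : (y \in s) = (y \in x0 :: p) || (y \in L).
  by rewrite sE LE !mem_cat mem_seq1 [in RHS]inE orbCA.
have [||||S [SV SC]] := @cycle_structure h.*2 (hypercube n) s.
- by move: nh (n2); clear; lia.
- rewrite /= size_cat /= sp size_map size_iota; move: nh (n1); clear; lia.
- rewrite sE uniq_catCA cat_uniq cat1s -LE uL up andbT; apply/hasPn => y /LR.
  by apply: contra => /Rp.
- have pw : path (@cube_adj n) (pair_vertex n 0 1) (rcons w (pair_vertex n 0 0)).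
    by move: cL; rewrite LE => /andP[].
  rewrite -[cycle _ _]/(path (@cube_adj n) (pair_vertex n 0 0) (rcons ((x0 :: p) ++ pair_vertex n 0 1 :: w) (pair_vertex n 0 0))).
  rewrite rcons_cat cat_path /= pp lp pw !andbT pair_vertex_adj //=.
  apply/cube_adjP; exists i2; apply: eq_from_tnth => j.
  rewrite !tnth_flip !tnth_mktuple -!val_eqE /=.
  by case: (j : nat) => [|[|[|]]].
have FV : family_vertices [set S] = [set x in s] by rewrite /family_vertices big_set1.
exists [set S]; last by rewrite cards1.
split; first by move=> S' /set1P ->.
(* The missing coordinate 0 keeps [v] off the detour, and its remaining coordinates, at least three,
   keep it off the zigzag. *)
pose v : n.-tuple bool := [tuple j != i0 | j < n].
apply: (@isolating_separating _ v); rewrite ?FV.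
- rewrite inE sP; apply/negP => /orP[/Rp/Rtrue[]|/Lpair[i [_ /esym/eqP]]]; first by rewrite tnth_zero.
  by rewrite (negPf (zigzag_neq_zero _ _ _)).
- rewrite inE sP; apply/negP => /orP[/Rp/Rtrue[]|/Lpair[i [_ E]]]; first by rewrite tnth_mktuple eqxx.
  have := @pair_vertex_two (0 + i./2 %% n) (0 + uphalf i %% n) i1 i2 i3 isT isT isT.
  by rewrite -/(zigzag n 0 n i) -E !tnth_mktuple.
- apply/eqP => E; have := congr1 (fun y : n.-tuple bool => tnth y i1) E.
  by rewrite !tnth_mktuple.
move=> l; rewrite inE sP flip_zero; apply/orP; right; apply/mapP; exists l.*2.
  by rewrite mem_iota /= ltn_double ltn_ord.
by rewrite zigzag_even.
Qed.

Lemma face_structure p (a c : 'I_n) : a != c ->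
  exists S : subgraph (hypercube n), sub_vertices S = face p a c /\
    isomorphic (graph_of_sub S) (cycle_graph 4).
Proof.
move=> ac; pose s : seq (hypercube n) := [:: p; flip a p; flip c (flip a p); flip c p].
have flip_inj l := inj_eq (inv_inj (@flipK n l)).
have p_ca : p != flip c (flip a p) by rewrite -(flip_inj c) flipK flip_eq eq_sym.
have ca_c : flip c (flip a p) != flip c p by rewrite flip_inj flip_neq.
have neq l x : x != flip l x by rewrite eq_sym flip_neq.
have [||||S [SV SC]] := @cycle_structure 4 (hypercube n) s => //.
- by rewrite /= !inE !negb_or !neq p_ca ca_c flip_eq ac.
- rewrite /= !cube_adj_flip andbT /=; apply/andP; split.
    by rewrite flipC cube_adj_sym cube_adj_flip.
  by rewrite cube_adj_sym cube_adj_flip.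
exists S; split=> //; rewrite SV; apply/setP => x; rewrite !inE -!orbA.
by rewrite [(x == flip c p) || _]orbC.
Qed.

Lemma in_face (p : n.-tuple bool) a c y : a != c ->
  (forall l, l != a -> l != c -> tnth y l = tnth p l) -> y \in face p a c.
Proof.
move=> ac yp.
have E z : tnth y a = tnth z a -> tnth y c = tnth z c ->
    (forall l, l != a -> l != c -> tnth z l = tnth p l) -> y = z.
  move=> ya yc zp; apply: eq_from_tnth => l.
  case: (eqVneq l a) => [-> //|la]; case: (eqVneq l c) => [-> //|lc].
  by rewrite yp ?zp.
have ca : (c == a) = false by rewrite eq_sym (negPf ac).
rewrite !inE; case: (eqVneq (tnth y a) (tnth p a)) => ya; case: (eqVneq (tnth y c) (tnth p c)) => yc.
- by rewrite (E p) ?eqxx.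
- rewrite (E (flip c p)) ?eqxx ?orbT // ?tnth_flip ?eqxx ?(negPf ac) ?addbF //.
    by move: yc; case: (tnth y c); case: (tnth p c).
  by move=> l la lc; rewrite tnth_flip ?(negPf la) ?(negPf lc) addbF.
- rewrite (E (flip a p)) ?eqxx ?orbT // ?tnth_flip ?eqxx ?ca ?addbF //.
    by move: ya; case: (tnth y a); case: (tnth p a).
  by move=> l la lc; rewrite tnth_flip ?(negPf la) ?(negPf lc) addbF.
rewrite (E (flip c (flip a p))) ?eqxx ?orbT // ?tnth_flip ?eqxx ?ca ?(negPf ac) ?addbF //.
- by move: ya; case: (tnth y a); case: (tnth p a).
- by move: yc; case: (tnth y c); case: (tnth p c).
- by move=> l la lc; rewrite !tnth_flip (negPf la) (negPf lc) !addbF.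
Qed.

(** The face [B] at the zero vertex in directions 0 and 1 can be left in [n - 2] directions, and
    each leads into one of the deleted parallel faces. *)
Lemma faces_cut : 3 < n -> exists2 F : {set subgraph (hypercube n)},
  structure_cut (cycle_graph 4) F & #|F| <= n - 2.
Proof.
move=> n3; have [n0 n1 n2] : [/\ 0 < n, 1 < n & 2 < n] by split; move: n3; clear; lia.
pose i0 : 'I_n := Ordinal n0; pose i1 : 'I_n := Ordinal n1.
pose i2 : 'I_n := Ordinal n2; pose i3 : 'I_n := Ordinal n3.
have dP (q : 'I_(n - 2)) : q.+2 < n by have := ltn_ord q; clear; lia.
pose d q := Ordinal (dP q).
have [F [FQ Fm FV]] := family_exists (fun q => face_structure (flip (d q) zero_vertex) (isT : i0 != i1)).
rewrite card_ord in Fm; exists F => //; split=> //.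
(* Vertices of the deleted faces have exactly one nonzero coordinate beyond the first two; the
   all-ones vertex has at least two because [3 < n]. *)
pose v : n.-tuple bool := [tuple true | _ < n].
pose B := [pred x : hypercube n | [forall l : 'I_n, (1 < l) ==> ~~ tnth (x : n.-tuple bool) l]].
have dj q (l : 'I_n) : 1 < l -> l != d q -> forall x, x \in face (flip (d q) zero_vertex) i0 i1 -> tnth x l = false.
  move=> l1 lq x /face_const -> ; first by rewrite tnth_flip tnth_zero (negPf lq).
    by apply: contraTneq l1 => ->.
  by apply: contraTneq l1 => ->.
apply: (@closed_separating (hypercube n) F B zero_vertex v).
- rewrite FV; apply/bigcupP => -[q _] /(face_const (l := d q)).
  by rewrite tnth_flip !tnth_zero eqxx => /(_ isT isT).
- rewrite FV; apply/bigcupP => -[q _ vq].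
  case: (eqVneq i2 (d q)) => [E|ne].
    by have := dj q i3 isT _ v vq; rewrite tnth_mktuple -E => /(_ isT).
  by have := dj q i2 isT ne v vq; rewrite tnth_mktuple.
- by rewrite inE; apply/forallP => l; rewrite tnth_zero implybT.
- by rewrite inE; apply/negP => /forallP/(_ i2); rewrite tnth_mktuple.
move=> x y yF /cube_adjP[l Ey] /forallP xB; apply/forallP => m; apply/implyP => m1.
have xB' (j : 'I_n) : 1 < j -> tnth (x : n.-tuple bool) j = false by move=> j1; apply/negbTE; apply: (implyP (xB j)).
case: (leqP l 1) => l1.
  rewrite Ey tnth_flip xB' //; apply: contraTN m1 => /eqP ->; by rewrite -leqNgt.
case/negP: yF; rewrite FV; have lq : l - 2 < n - 2 by have := ltn_ord l; move: l1; clear; lia.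
apply/bigcupP; exists (Ordinal lq) => //; apply: in_face => // j j0 j1.
have -> : d (Ordinal lq) = l by apply: ord_inj => /=; move: l1; clear; lia.
rewrite Ey !tnth_flip tnth_zero xB' //; move: j0 j1; rewrite -!val_eqE /=; clear; lia.
Qed.

(** Cycles through all the vertices leave the empty graph, so some cut exists and hence a
    minimum. *)
Lemma all_cycles_cut h : 0 < n -> 1 < h -> h.*2 <= 2 ^ n ->
  exists F : {set subgraph (hypercube n)}, structure_cut (cycle_graph h.*2) F.
Proof.
move=> n0 h1 hn.
have H (x : n.-tuple bool) : exists S : subgraph (hypercube n), x \in sub_vertices S /\
    isomorphic (graph_of_sub S) (cycle_graph h.*2).
  have [s [ss us cs xs]] := cycle_through x n0 h1 hn.
  have [||||S [SV SC]] := @cycle_structure h.*2 (hypercube n) s => //.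
    by move: h1; clear; lia.
  by exists S; rewrite SV inE.
have [f fP] := fin_all_exists H; exists (f @: setT); split.
  by move=> S /imsetP[x _ ->]; case: (fP x).
apply: cover_separating; apply/setP => x; rewrite inE; apply/bigcupP.
by exists (f x); [exact: imset_f | case: (fP x)].
Qed.

End Cuts.

(** Two opposite faces cover the whole cube. *)
Lemma cube3_cut : exists2 F : {set subgraph (hypercube 3)},
  structure_cut (cycle_graph 4) F & #|F| <= 2.
Proof.
pose i0 : 'I_3 := @Ordinal 3 0 isT; pose i1 : 'I_3 := @Ordinal 3 1 isT; pose i2 : 'I_3 := @Ordinal 3 2 isT.
pose z (b : bool) : 3.-tuple bool := if b then flip i2 (zero_vertex 3) else zero_vertex 3.
have [F [FQ Fm FV]] := family_exists (fun b => face_structure (z b) (isT : i0 != i1)).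
rewrite card_bool in Fm; exists F => //; split=> //; apply: cover_separating.
rewrite FV; apply/setP => x; rewrite inE; apply/bigcupP; exists (tnth (x : 3.-tuple bool) i2) => //.
apply: in_face => // l l0 l1; have -> : l = i2.
  by apply: ord_inj; move: l0 l1; rewrite -!val_eqE /=; have := ltn_ord l; clear; lia.
rewrite /z; case: (tnth x i2); by rewrite ?tnth_flip tnth_zero ?eqxx.
Qed.

(** * Lower bounds and exact values *)

Lemma substructure_lower n k F : 2 < n -> 2 < k ->
  @substructure_cut (hypercube n) (cycle_graph k) F -> n <= #|F| * uphalf k.
Proof.
move=> n2 k2 [FP sF]; rewrite leqNgt; apply/negP => Fn.
exact: (few_pieces_not_separating n2 k2 FP Fn sF).
Qed.

Lemma structure_lower n k F : 2 < n -> 2 < k ->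
  @structure_cut (hypercube n) (cycle_graph k) F -> n <= #|F| * uphalf k.
Proof.
move=> n2 k2 [FP sF]; apply: substructure_lower => //; split=> // S SF.
by apply: cycle_is_piece (FP S SF); apply: ltn_trans k2.
Qed.

(** The hypothesis on [m] characterises the ceiling of [n / uphalf k], which treats odd and even [k]
    together. *)
Lemma kappa_s_cycle n k m : 2 < n -> 2 < k -> (forall t, (m <= t) = (n <= t * uphalf k)) ->
  is_kappa_s (hypercube n) (cycle_graph k) m.
Proof.
move=> n2 k2 mE; apply: min_card_intro.
  have [F FP Fm] := @pieces_cut n k m n2 k2 (etrans (esym (mE m)) (leqnn m)).
  by exists F.
by move=> F /(substructure_lower n2 k2); rewrite mE.
Qed.

Lemma ceil_div_half n r t : 0 < r -> (ceil_div (2 * n) r.*2 <= t) = (n <= t * r).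
Proof. by move=> r0; rewrite ceil_div_leq ?double_gt0 // -mul2n mulnCA leq_pmul2l. Qed.

Theorem theorem23 (n : nat) (hn : 3 <= n) :
  ((forall k : nat, odd k -> 3 <= k <= 2 ^ (n - 1) ->
      is_kappa_s (hypercube n) (cycle_graph k) (ceil_div (2 * n) (k + 1))) /\
   (forall k : nat, ~~ odd k -> 4 <= k <= 2 ^ (n - 1) ->
      is_kappa_s (hypercube n) (cycle_graph k) (ceil_div (2 * n) k))) /\
  ((n = 3 -> is_kappa (hypercube n) (cycle_graph 4) 2) /\
   (4 <= n -> is_kappa (hypercube n) (cycle_graph 4) (n - 2)) /\
   (forall k : nat, 5 <= n -> ~~ odd k -> 6 <= k <= 2 ^ (n - 2) ->
      is_kappa (hypercube n) (cycle_graph k) (ceil_div (2 * n) k)) /\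
   (forall k : nat, 4 <= n -> ~~ odd k ->
      2 ^ (n - 2) + 2 <= k <= 2 ^ (n - 1) ->
      exists2 m : nat, is_kappa (hypercube n) (cycle_graph k) m
        & ceil_div (2 * n) k <= m)).
Proof.
split; split.
- move=> k ko /andP[k3 _]; apply: kappa_s_cycle => // t.
  have -> : k + 1 = (uphalf k).*2 by move: ko; clear; lia.
  by apply: ceil_div_half; move: k3; clear; lia.
- move=> k ke /andP[k4 _]; apply: kappa_s_cycle => // [|t]; first exact: ltnW.
  have {1}-> : k = (uphalf k).*2 by move: ke; clear; lia.
  by apply: ceil_div_half; move: k4; clear; lia.
- move=> n3; subst n; apply: min_card_intro cube3_cut _ => F /(structure_lower hn (isT : 2 < 4)).
  by rewrite [uphalf 4]/=; clear; lia.
split; [| split].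
- move=> n4; apply: min_card_intro (faces_cut n4) _ => F [FP sF].
  rewrite leqNgt; apply/negP => Fn; apply: few_faces_not_separating sF => //.
  by move: n4 Fn; clear; lia.
- move=> k n5 ke /andP[k6 kn].
  have [h kE] : exists h, k = h.*2 by exists k./2; rewrite even_halfK.
  subst k; have h3 : 2 < h by move: k6; clear; lia.
  have h0 : 0 < h by apply: ltn_trans h3.
  apply: min_card_intro; last first.
    by move=> F /(structure_lower hn) H; rewrite ceil_div_half // -(uphalf_double h) H //; move: h3; clear; lia.
  (* Up to [h = n], zigzag cycles through [h] neighbours each suffice; beyond, a single long cycle
     does, and the ceiling is positive. *)
  have [hn'|nh] := leqP h n.
    by apply: cycles_cut => //; rewrite ?h3 // -ceil_div_half.
  have [F FP F1] := long_cycle_cut n5 nh kn; exists F => //.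
  apply: leq_trans F1 _; rewrite ltnNge ceil_div_half //; move: hn; clear; lia.
move=> k n4 ke /andP[kl kn].
have k3 : 3 < k.
  have : 2 ^ 2 <= 2 ^ (n - 2) by rewrite leq_exp2l //; move: n4; clear; lia.
  by move: kl; clear; lia.
have [h kE] : exists h, k = h.*2 by exists k./2; rewrite even_halfK.
subst k; have h1 : 1 < h by move: k3; clear; lia.
have hn' : h.*2 <= 2 ^ n by apply: leq_trans kn _; rewrite leq_exp2l // leq_subr.
(* Any cut yields a minimum one, to which the lower bound applies. *)
have [F FP] := all_cycles_cut (ltn_trans (isT : 0 < 2) hn) h1 hn'.
have [m mP] := min_card_exists FP; exists m => //.
have [[F' [FP' <-]] _] := mP; rewrite ceil_div_half ?(ltnW h1) // -[in X in _ * X](uphalf_double h).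
by apply: (structure_lower hn _ FP'); apply: ltnW.
Qed.
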